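(* Let $X$ be an infinite connected simple graph (undirected, countable, all vertex degrees finite), and let $\deg X\in\mathbb{Z}^+\cup\{\infty\}$ be the supremum of its vertex degrees. Then $DI_L(X)\le2(\deg X-1)$ and, if $X$ is repetitive, $DI_{RL}(X)\le2(\deg X-1)$.
   Context: A connected graph $X$ (identified with its vertex set, with edge set $E$) has the metric $d$ given by minimal path length; $D_X(x,R)=\{y\in X:d(x,y)\le R\}$, regarded as an induced subgraph. An edge coloring by $n$ colors is a map $\psi:E\to\{0,\dots,n-1\}$. Isomorphisms of pointed edge-colored graphs are graph isomorphisms preserving base points and the colors of edges. For edge-colored connected graphs with finite vertex degrees, $(Y,\theta)$ with a base point $y$ is a limit of $(X,\psi)$ if for every $R\in\mathbb{Z}^+$ there is $x\in X$ such that the pointed edge-colored disks $(D_X(x,R),x,\psi)$ and $(D_Y(y,R),y,\theta)$ are isomorphic. $(X,\psi)$ is aperiodic if its only edge-color-preserving graph automorphism is the identity; limit aperiodic if every limit $(Y,\theta)$ is aperiodic; and repetitive if there are $p\in X$ and $R_i\uparrow\infty$ in $\mathbb{Z}^+$ such that, for every $i$, the set of $x\in X$ with $(D_X(x,R_i),x,\psi)\cong(D_X(p,R_i),p,\psi)$ is relatively dense in $X$ (every vertex is at bounded distance from it). An uncolored graph is repetitive if the same holds with the colorings omitted. $DI_L(X)$ is the infimum of the $n\in\mathbb{Z}^+$ such that $X$ has a limit aperiodic edge coloring by $n$ colors; for $X$ repetitive, $DI_{RL}(X)$ is the infimum of the $n\in\mathbb{Z}^+$ such that $X$ has a repetitive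 limit aperiodic edge coloring by $n$ colors ($\inf\emptyset=\infty$). *)

(* Defs.v *)
From HB Require Import structures.
From mathcomp Require Import all_boot all_order all_algebra finmap.
From mathcomp Require Import all_classical all_reals all_analysis.

Set Implicit Arguments.
Unset Strict Implicit.
Unset Printing Implicit Defensive.

Import Order.TTheory GRing.Theory Num.Theory.

Local Open Scope classical_set_scope.

Record graph := Graph {
  vertex :> choiceType;
  adj : rel vertex;
  adj_sym : symmetric adj;
  adj_irr : irreflexive adj }.

(* [path adj x p] says that [x :: p] is a walk; its length is [size p]. *)
Definition path_lengths (G : graph) (x y : G) : set nat :=
  [set n | exists p : seq G,
     [/\ path (@adj G) x p, last x p = y & size p = n]].

Definition graph_connected (G : graph) : Prop :=
  forall x y : G, path_lengths x y !=set0.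

Definition neighbors (G : graph) (x : G) : set G := [set y | adj x y].

Definition locally_finite (G : graph) : Prop :=
  forall x : G, finite_set (neighbors x).

Definition degree (G : graph) (x : G) : nat := #|` fset_set (neighbors x)|.

Definition graph_degree (R : realType) (G : graph) : \bar R :=
  ereal_sup [set ((degree x)%:R%:E)%E | x in [set: G]].

(* Junk value 0 when x and y are in different components. *)
Definition dist (G : graph) (x y : G) : nat :=
  xget 0 [set n | path_lengths x y n /\
                  forall m, path_lengths x y m -> n <= m].

Definition disk (G : graph) (x : G) (r : nat) : set G :=
  [set y | dist x y <= r].

Lemma dist_refl (G : graph) (x : G) : dist x x = 0.
Proof.
rewrite /dist; case: xgetP => // n _ [_ nmin].
by apply/eqP; rewrite -leqn0; apply: nmin; exists [::].
Qed.

Lemma disk_center_subproof (G : graph) (x : G) (r : nat) : x \in disk x r.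
Proof. by apply: mem_set; rewrite /disk /= dist_refl. Qed.

Definition induced (G : graph) (A : set G) : graph :=
  @Graph (set_type A) (fun u v => adj (val u) (val v))
    (fun u v => adj_sym (val u) (val v)) (fun u => adj_irr (val u)).

Definition disk_graph (G : graph) (x : G) (r : nat) : graph :=
  induced (disk x r).

Definition disk_center (G : graph) (x : G) (r : nat) : disk_graph x r :=
  SigSub (disk_center_subproof x r).

(* A map on the undirected edges, encoded as a map on oriented edges that is
   invariant under reversal. *)
Record coloring (G : graph) (C : Type) := Coloring {
  color :> forall x y : G, adj x y -> C;
  color_sym : forall (x y : G) (xy : adj x y) (yx : adj y x),
    color xy = color yx }.

Definition induced_coloring (G : graph) (C : Type) (psi : coloring G C)
    (A : set G) : coloring (induced A) C :=
  @Coloring (induced A) C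
    (fun u v uv => psi (val u) (val v) uv)
    (fun u v uv vu => color_sym psi uv vu).

Definition disk_coloring (G : graph) (C : Type) (psi : coloring G C) (x : G)
    (r : nat) : coloring (disk_graph x r) C :=
  induced_coloring psi (disk x r).

Definition graph_iso (G H : graph) (f : G -> H) : Prop :=
  bijective f /\ forall x y : G, adj (f x) (f y) = adj x y.

Definition color_preserving (G H : graph) (C : Type) (psi : coloring G C)
    (theta : coloring H C) (f : G -> H) : Prop :=
  forall (x y : G) (xy : adj x y) (fxy : adj (f x) (f y)),
    theta (f x) (f y) fxy = psi x y xy.

Definition disk_equiv (G H : graph) (x : G) (y : H) (r : nat) : Prop :=
  exists f : disk_graph x r -> disk_graph y r,
    graph_iso f /\ f (disk_center x r) = disk_center y r.

Definition colored_disk_equiv (G H : graph) (C : Type) (psi : coloring G C)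
    (theta : coloring H C) (x : G) (y : H) (r : nat) : Prop :=
  exists f : disk_graph x r -> disk_graph y r,
    [/\ graph_iso f, f (disk_center x r) = disk_center y r &
        color_preserving (disk_coloring psi x r) (disk_coloring theta y r) f].

Definition is_limit (G H : graph) (C : Type) (psi : coloring G C)
    (theta : coloring H C) (y : H) : Prop :=
  forall r : nat, 0 < r -> exists x : G, colored_disk_equiv psi theta x y r.

Definition aperiodic (G : graph) (C : Type) (psi : coloring G C) : Prop :=
  forall f : G -> G, graph_iso f -> color_preserving psi psi f ->
    forall x, f x = x.

Definition limit_aperiodic (G : graph) (C : Type) (psi : coloring G C) : Prop :=
  forall (H : graph) (theta : coloring H C) (y : H),
    graph_connected H -> locally_finite H -> is_limit psi theta y ->
    aperiodic theta.

Definition relatively_dense (G : graph) (S : set G) : Prop :=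
  exists c : nat, forall x : G, exists2 s, S s & dist x s <= c.

Definition repetitive_for (G : graph) (E : G -> G -> nat -> Prop) : Prop :=
  exists (p : G) (r : nat -> nat),
    [/\ forall i, 0 < r i,
        {homo r : i j / i <= j},
        forall N, exists i, N <= r i &
        forall i, relatively_dense [set x | E x p (r i)]].

Definition repetitive (G : graph) : Prop :=
  repetitive_for (@disk_equiv G G).

Definition colored_repetitive (G : graph) (C : Type) (psi : coloring G C) :
    Prop :=
  repetitive_for (@colored_disk_equiv G G C psi psi).

Definition DI_L (R : realType) (G : graph) : \bar R :=
  ereal_inf [set (n%:R%:E)%E | n in
    [set n : nat | 0 < n /\ exists psi : coloring G 'I_n,
                              limit_aperiodic psi]].

Definition DI_RL (R : realType) (G : graph) : \bar R :=
  ereal_inf [set (n%:R%:E)%E | n in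
    [set n : nat | 0 < n /\ exists psi : coloring G 'I_n,
                              colored_repetitive psi /\ limit_aperiodic psi]].

(* Main.v *)
Require Import Defs.
From HB Require Import structures.
From mathcomp Require Import all_boot all_order all_algebra finmap.
From mathcomp Require Import all_classical all_reals all_analysis.
From mathcomp Require Import zify ring lra.

(** Let D be the largest degree. If the degrees are unbounded, the right-hand
    sides are infinite; otherwise D >= 2, because X is infinite and connected.

    Separated colorings. A coloring is limit aperiodic as soon as it is
    [separated]: for every n there is a length m such that, for distinct x and y
    at distance at most n, some simple path of length m from x has a color
    sequence that no simple path from y has. An automorphism of a limit that
    moves a vertex would, read inside a large disk of X, carry such a path to a
    forbidden one ([separated_limit_aperiodic]).

    Labels on a tree. Root X at o and choose a geodesic spanning tree. Its edges
    get labels 0, ..., D - 1 and all other edges get the label D. This takes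
    D + 1 <= 2 (D - 1) colors when D >= 3, and when D = 2 there are no other edges
    ([path_graph_edge]). The child number i of u gets the label i + s(u) modulo D,
    so siblings have distinct labels, while s(u) remains free. A simple path in a
    tree ascends for a while and then descends. Far from the root it is therefore
    enough that, in windows whose length depends on n only, (I) the ascending
    paths from distinct x and y with d(x, y) <= n have different labels, and
    (II) an ascending path and a descending path that start at distance at most n
    have different labels ([walk_separated]).

    Greedy choice of s. Below a given vertex there are at most (D - 1)^L
    descending paths of length L, and each carries boundedly many coincidences of
    type (I) or (II) to be excluded. A coincidence that has held so far survives
    the choice of s(u) for one value of s(u) out of D. Choosing s outward from
    the root, so that a weighted count of the coincidences in progress always
    drops by the factor D, keeps that count below 1, because ((D - 1) / D)^L beats
    the number of competitors once L is large ([avoid_events], [window]). A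
    completed coincidence would alone count 1, so there is none.

    Removing the root. Only vertices far from o are separated, uniformly in o. A
    cluster point of such colorings, as o goes to infinity, is separated
    everywhere ([cluster_coloring], [exists_separated]).

    Repetitivity. Order colorings by inclusion of their sets of finite patterns
    ([occurs]). Compactness and Zorn's lemma give a minimal coloring below a given
    one. Limit aperiodicity descends along this order, and on a repetitive graph a
    minimal coloring is repetitive: a pattern missing from arbitrarily large
    regions would be missing from some coloring pulled back from such regions,
    which is then strictly smaller ([minimal_repetitive]). *)

Set Implicit Arguments.
Unset Strict Implicit.
Unset Printing Implicit Defensive.

Import Order.TTheory GRing.Theory Num.Theory.

(** * Paths, distances and balls *)

Lemma infinite_inhabited (T : choiceType) :
  infinite_set [set: T]%classic -> exists x : T, True.
Proof.
move=> inf; apply: contrapT => nx; apply: inf.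
by apply: (sub_finite_set _ (finite_set0 T)) => x _; case: nx; exists x.
Qed.

Section Distance.
Variable G : graph.
Implicit Types (x y z : G) (p : seq G).

Lemma path_adj_rev x p : path (@adj G) x p ->
  path (@adj G) (last x p) (rev (belast x p)).
Proof.
by rewrite rev_path; apply: sub_path => a b; rewrite adj_sym.
Qed.

Lemma dist_le_path x p : path (@adj G) x p -> dist x (last x p) <= size p.
Proof.
move=> xp; rewrite /dist; case: xgetP => [n _ [_ nmin]|//].
by apply: nmin; exists p.
Qed.

Hypothesis conn : graph_connected G.

Lemma dist_path x y :
  exists p, [/\ path (@adj G) x p, last x p = y & size p = dist x y].
Proof.
have [n0 pn0] := conn x y.
have ex : exists n, `[< path_lengths x y n >] by exists n0; apply/asboolP.
rewrite /dist; case: xgetP => [n _ [[p [xp lp sp]] _]|]; first by exists p.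
case: (ex_minnP ex) => n /asboolP pn nmin /(_ n) [].
by split=> // m pm; apply: nmin; apply/asboolP.
Qed.

Lemma dist_eq0 x y : dist x y = 0 -> x = y.
Proof. by have [[|a p] [_ /= <- <-]] := dist_path x y. Qed.

Lemma dist_sym x y : dist x y = dist y x.
Proof.
suff le (a b : G) : dist a b <= dist b a by apply/eqP; rewrite eqn_leq !le.
have [p [bp lp <-]] := dist_path b a.
have := dist_le_path (path_adj_rev bp); rewrite size_rev size_belast.
suff -> : last (last b p) (rev (belast b p)) = b by rewrite lp.
by case: p {bp lp} => //= c p; rewrite rev_cons last_rcons.
Qed.

Lemma dist_triangle y x z : dist x z <= dist x y + dist y z.
Proof.
have [p [xp lp <-]] := dist_path x y; have [p' [yp lp' <-]] := dist_path y z.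
rewrite -size_cat -lp' -{1}lp -last_cat; apply: dist_le_path.
by rewrite cat_path xp lp.
Qed.

Lemma dist_adj x y : adj x y -> dist x y <= 1.
Proof. by move=> xy; apply: (@dist_le_path x [:: y]); rewrite /= xy. Qed.

Lemma dist_closer o x : x != o ->
  exists2 y, adj x y & dist o x = (dist o y).+1.
Proof.
have [p [op lp sp]] := dist_path o x.
case/lastP: p op lp sp => [|p y] /=; first by move=> _ -> _; rewrite eqxx.
rewrite rcons_path last_rcons size_rcons => /andP[op py] yx sp _; subst y.
exists (last o p); first by rewrite adj_sym.
apply/eqP; rewrite eqn_leq; apply/andP; split.
  apply: leq_trans (dist_triangle (last o p) o x) _.
  by rewrite -addn1 leq_add2l dist_adj.
by rewrite -sp ltnS dist_le_path.
Qed.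

Lemma dist_mem_path x p v : path (@adj G) x p -> v \in x :: p ->
  dist x v <= size p.
Proof.
move=> xp vp; case/splitPl: vp xp => p1 p2 <-; rewrite cat_path => /andP[xp1 _].
by rewrite size_cat (leq_trans (dist_le_path xp1)) ?leq_addr.
Qed.

Hypothesis lf : locally_finite G.

Definition nbrs x : seq G := fset_set (neighbors x).

Lemma mem_nbrs x y : (y \in nbrs x) = adj x y.
Proof. by rewrite /nbrs in_fset_set // mem_setE. Qed.

Lemma uniq_nbrs x : uniq (nbrs x).
Proof. exact: fset_uniq. Qed.

Lemma size_nbrs x : size (nbrs x) = degree x.
Proof. by []. Qed.

(** A list that contains the closed ball; it has repetitions, so its size only
    bounds the number of vertices at distance at most n. *)
Fixpoint ball n x : seq G :=
  if n is m.+1 then flatten [seq ball m y | y <- x :: nbrs x] else [:: x].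

Lemma mem_ball n x y : dist x y <= n -> y \in ball n x.
Proof.
elim: n x => [|n IH] x; first by rewrite leqn0 => /eqP /dist_eq0 ->; rewrite inE.
move=> xy; apply/flatten_mapP.
have [yx|yx] := eqVneq x y.
  exists x; first exact: mem_head.
  by apply: IH; rewrite yx dist_refl.
have [z xz dz] := dist_closer yx.
exists z; first by rewrite inE mem_nbrs xz orbT.
by apply: IH; move: xy; rewrite dist_sym dz ltnS dist_sym.
Qed.

Lemma size_ball D n x : (forall u : G, degree u <= D) -> size (ball n x) <= D.+1 ^ n.
Proof.
move=> deg; elim: n x => [|n IH] x //.
rewrite -[ball n.+1 x]/(flatten [seq ball n y | y <- x :: nbrs x]) size_flatten.
rewrite /shape -map_comp.
suff le s : sumn [seq (size \o ball n) i | i <- s] <= size s * D.+1 ^ n.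
  by rewrite (leq_trans (le _)) // expnS leq_mul2r /= size_nbrs ltnS deg orbT.
by elim: s => //= y s IHs; rewrite mulSn leq_add.
Qed.

Lemma far_vertex (o : G) n : infinite_set [set: G]%classic -> exists y, n < dist o y.
Proof.
move=> inf; apply: contrapT => near; apply: inf.
apply: (sub_finite_set _ (finite_seq (ball n o))) => y _ /=.
apply: mem_ball; rewrite leqNgt; apply/negP => lt; apply: near; by exists y.
Qed.

(** Some vertex is at distance 2 or more from a given one, and its predecessor on
    a shortest path has two neighbors. *)
Lemma degree_ge2 : infinite_set [set: G]%classic ->
  exists u : G, 2 <= degree u.
Proof.
move=> X_infinite.
have [x0 _] := infinite_inhabited X_infinite.
have [v v1] := far_vertex x0 1 X_infinite.
have vx : v != x0 by apply: contraTneq v1 => ->; rewrite dist_refl.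
have [w vw dw] := dist_closer vx.
have wx : w != x0 by apply: contraTneq v1 => wx; rewrite dw wx dist_refl.
have [u wu du] := dist_closer wx.
exists w; rewrite -size_nbrs; apply: (@uniq_leq_size _ [:: u; v]) => [|a].
  by rewrite /= andbT inE; apply/eqP => uv; move: dw du; rewrite uv; lia.
by rewrite !inE mem_nbrs // => /orP[] /eqP -> //; rewrite adj_sym.
Qed.

End Distance.

(** * Colored disks and separated colorings *)

Section Labels.
Variables (G : graph) (C : Type).
Implicit Type psi : coloring G C.

(** Adjacency and color in one function of two vertices, without proofs of
    adjacency: a map preserves [lab] exactly when it preserves edges, non-edges
    and colors. *)
Definition lab psi (u v : G) : option C :=
  if pselect (adj u v) is left uv then Some (psi u v uv) else None.

Lemma lab_adj psi u v (uv : adj u v) : lab psi u v = Some (psi u v uv).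
Proof.
rewrite /lab; case: pselect => [h|nuv]; last by case: (nuv uv).
by rewrite (bool_irrelevance h uv).
Qed.

Lemma lab_nadj psi u v : ~~ adj u v -> lab psi u v = None.
Proof. by move=> nuv; rewrite /lab; case: pselect => // uv; rewrite uv in nuv. Qed.

Lemma isSome_lab psi u v : isSome (lab psi u v) = adj u v.
Proof. by rewrite /lab; case: pselect => [h|/negP/negbTE ->] //; rewrite h. Qed.

Lemma path_pairmap psi (x : G) p :
  path (@adj G) x p = all isSome (pairmap (lab psi) x p).
Proof. by elim: p x => //= a p IH x; rewrite isSome_lab IH. Qed.

End Labels.

(** An isomorphism of pointed colored disks and its inverse, given by total maps
    of the ambient graphs whose values outside the disks do not matter. Composing
    and restricting these avoids the sigma types of disks. *)
Definition chart (G H : graph) (C : Type) (psi : coloring G C)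
    (theta : coloring H C) (x : G) (y : H) r (F : G -> H) (F' : H -> G) : Prop :=
  [/\ F x = y,
      forall u, dist x u <= r -> dist y (F u) <= r /\ F' (F u) = u,
      forall v, dist y v <= r -> dist x (F' v) <= r /\ F (F' v) = v &
      forall u v, dist x u <= r -> dist x v <= r ->
        lab theta (F u) (F v) = lab psi u v].

Lemma disk_graphP (G : graph) (x : G) r (u : disk_graph x r) : dist x (val u) <= r.
Proof. exact: (set_valP (u : set_type (disk x r))). Qed.

Section Charts.
Variables (G H : graph) (C : Type).
Variables (psi : coloring G C) (theta : coloring H C).

Lemma colored_disk_equivP (x : G) (y : H) r :
  colored_disk_equiv psi theta x y r <-> exists F F', chart psi theta x y r F F'.
Proof.
split=> [[f [[[g fK gK] fadj] fc fcol]]|[F [F' [Fx FD F'D Flab]]]].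
  pose F u := if insub u is Some u' then val (f u') else y.
  pose F' v := if insub v is Some v' then val (g v') else x.
  have FE u (h : u \in disk x r) : F u = val (f (SigSub h)).
    by rewrite /F insubT.
  have F'E v (h : v \in disk y r) : F' v = val (g (SigSub h)).
    by rewrite /F' insubT.
  exists F, F'; split.
  - by rewrite (FE _ (disk_center_subproof x r)) -[SigSub _]/(disk_center x r) fc.
  - move=> u xu; have h : u \in disk x r by apply: mem_set.
    rewrite (FE _ h); split; first exact: disk_graphP.
    rewrite (F'E _ (valP (f (SigSub h)))).
    rewrite (_ : SigSub _ = f (SigSub h)) ?fK //; exact: val_inj.
  - move=> v yv; have h : v \in disk y r by apply: mem_set.
    rewrite (F'E _ h); split; first exact: disk_graphP.
    rewrite (FE _ (valP (g (SigSub h)))).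
    rewrite (_ : SigSub _ = g (SigSub h)) ?gK //; exact: val_inj.
  - move=> u v xu xv; have hu : u \in disk x r by apply: mem_set.
    have hv : v \in disk x r by apply: mem_set.
    rewrite (FE _ hu) (FE _ hv).
    have := fadj (SigSub hu) (SigSub hv) => /=.
    case: (boolP (adj u v)) => [uv fuv|nuv fuv]; last first.
      by rewrite !lab_nadj ?fuv.
    rewrite (lab_adj _ uv) (lab_adj _ fuv); congr Some.
    exact: (fcol (SigSub hu) (SigSub hv) uv fuv).
have fP (u : disk_graph x r) : F (val u) \in disk y r.
  by apply: mem_set; case: (FD (val u)) => //; exact: disk_graphP.
have gP (v : disk_graph y r) : F' (val v) \in disk x r.
  by apply: mem_set; case: (F'D (val v)) => //; exact: disk_graphP.
exists (fun u => SigSub (fP u)); split.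
- split.
    exists (fun v => SigSub (gP v)) => [u|v]; apply: val_inj => /=.
      by case: (FD (val u)) => //; exact: disk_graphP.
    by case: (F'D (val v)) => //; exact: disk_graphP.
  move=> u v /=; rewrite -(isSome_lab theta) -(isSome_lab psi) Flab //;
    exact: disk_graphP.
- exact: val_inj.
- move=> u v uv fuv /=.
  have := Flab (val u) (val v) (disk_graphP _) (disk_graphP _).
  rewrite (lab_adj _ (uv : adj (val u) (val v))).
  by rewrite (lab_adj _ (fuv : adj (F (val u)) (F (val v)))) => -[].
Qed.

Lemma chart_sym x y r F F' :
  chart psi theta x y r F F' -> chart theta psi y x r F' F.
Proof.
move=> [Fx FD F'D Flab]; split=> //.
  by rewrite -Fx; case: (FD x); rewrite ?dist_refl.
move=> u v /F'D[xu Fu] /F'D[xv Fv].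
by rewrite -{2}Fu -{2}Fv Flab.
Qed.

End Charts.

Lemma chart_trans (G H K : graph) (C : Type) (psi : coloring G C)
    (theta : coloring H C) (chi : coloring K C) x y z r F F' F1 F1' :
  chart psi theta x y r F F' -> chart theta chi y z r F1 F1' ->
  chart psi chi x z r (F1 \o F) (F' \o F1').
Proof.
move=> [Fx FD F'D Flab] [F1x F1D F1'D F1lab]; split => /=.
- by rewrite Fx.
- by move=> u /FD[yu Fu]; case: (F1D _ yu) => zu ->.
- by move=> v /F1'D[yv Fv]; case: (F'D _ yv) => xv ->.
- by move=> u v xu xv; rewrite F1lab ?Flab //; [case: (FD _ xu)|case: (FD _ xv)].
Qed.

Section ChartPaths.
Variables (G H : graph) (C : Type).
Variables (psi : coloring G C) (theta : coloring H C).
Hypothesis connG : graph_connected G.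
Variables (x : G) (y : H) (r : nat) (F : G -> H) (F' : H -> G).
Hypothesis Fchart : chart psi theta x y r F F'.

(** The hypothesis keeps the whole path inside the disk, where the chart is
    defined. *)
Lemma chart_path u p : path (@adj G) u p -> dist x u + size p <= r ->
  path (@adj H) (F u) (map F p).
Proof.
have [_ _ _ Flab] := Fchart.
elim: p u => //= v p IH u /andP[uv vp] le.
have xv : dist x v <= (dist x u).+1.
  rewrite (leq_trans (dist_triangle connG u _ _)) // -addn1 leq_add2l.
  exact: dist_adj.
rewrite -(isSome_lab theta) Flab ?isSome_lab ?uv /=.
- by apply: IH => //; lia.
- by lia.
- by lia.
Qed.

Lemma chart_dist u v : dist x u + dist u v <= r -> dist (F u) (F v) <= dist u v.
Proof.
have [p [up <- <-]] := dist_path connG u v => le.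
by rewrite -(size_map F p) -last_map; apply/dist_le_path/chart_path.
Qed.

End ChartPaths.

(** Distances inside a disk agree with those of the ambient graph only when
    shortest paths stay in the disk. Under the assumption on r', disks of radius
    r' around u are metrically correct, so the chart maps them to each other. *)
Lemma chart_sub (G H : graph) (C : Type) (psi : coloring G C)
    (theta : coloring H C) (connG : graph_connected G) (connH : graph_connected H)
    x y r F F' u r' :
  chart psi theta x y r F F' -> dist x u + r' <= r ->
  chart psi theta u (F u) r' F F'.
Proof.
move=> Fch le; have Fch' := chart_sym Fch.
have [Fx FD F'D Flab] := Fch.
have xu : dist x u <= r by lia.
have near v : dist u v <= r' -> dist x v <= r.
  move=> uv; have := dist_triangle connG u x v; lia.
have yFu : dist y (F u) <= dist x u.
  by rewrite -{1}Fx; apply: (chart_dist connG Fch); rewrite dist_refl.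
have near' v : dist (F u) v <= r' -> dist y v <= r.
  move=> uv; have := dist_triangle connH (F u) y v; lia.
split=> //.
- move=> v uv; have [_ F'v] := FD v (near _ uv); split=> //.
  by rewrite (leq_trans (chart_dist connG Fch _)) //; lia.
- move=> v uv; have [_ F'v] := F'D v (near' _ uv); split=> //.
  have [_ {1}<-] := FD u xu.
  by rewrite (leq_trans (chart_dist connH Fch' _)) //; lia.
- by move=> v w /near xv /near xw; apply: Flab.
Qed.

Lemma pairmap_map_in (A : eqType) (B T : Type) (f : A -> A -> T) (g : B -> B -> T)
    (h : A -> B) (a : A) (p : seq A) :
  {in a :: p &, forall v w, g (h v) (h w) = f v w} ->
  pairmap g (h a) (map h p) = pairmap f a p.
Proof.
elim: p a => //= b p IH a gf.
rewrite gf ?inE ?eqxx ?orbT // IH // => v w vp wp.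
by apply: gf; rewrite inE ?vp ?wp orbT.
Qed.

Lemma eq_in_pairmap (A : eqType) (T : Type) (f g : A -> A -> T) (a : A) (p : seq A) :
  {in a :: p &, f =2 g} -> pairmap f a p = pairmap g a p.
Proof.
by move=> fg; rewrite -{1}(map_id p); exact: (@pairmap_map_in A A T g f id a p).
Qed.

(** Distinguishing x from y by a path, rather than by non-isomorphic disks, gives
    a property of the colors on a finite set, which passes to limits of
    colorings. The length m depends only on n: this uniformity is what survives
    in limits of the graph. *)
Definition separated (G : graph) (C : Type) (psi : coloring G C) : Prop :=
  forall n, exists m, forall x y : G, x != y -> dist x y <= n ->
    exists p, [/\ size p = m, path (@adj G) x p, uniq (x :: p) &
      forall p', uniq (y :: p') -> pairmap (lab psi) x p <> pairmap (lab psi) y p'].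

Section LimitAperiodic.
Variables (G : graph) (C : Type) (psi : coloring G C).
Hypothesis connG : graph_connected G.

(** Let an automorphism f of a limit move u by n. A chart at a large radius turns
    u and f u into distinct vertices a and b of G at distance at most n, and turns
    f into a color preserving map h, defined near a, with h a = b. Then h sends
    the path that separates a from b to a path from b with the same colors. *)
Lemma separated_limit_aperiodic : separated psi -> limit_aperiodic psi.
Proof.
move=> sep H theta y connH _ lim f [[f' fK f'K] fadj] fcol u.
apply: contrapT => /eqP fu_neq; set n := dist u (f u).
have flab v w : lab theta (f v) (f w) = lab theta v w.
  case: (boolP (adj v w)) => [vw|nvw]; last by rewrite !lab_nadj ?fadj.
  have fvw : adj (f v) (f w) by rewrite fadj.
  by rewrite (lab_adj _ vw) (lab_adj _ fvw) (fcol _ _ vw fvw).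
have fdist v w : dist (f v) (f w) <= dist v w.
  have [p [vp <- <-]] := dist_path connH v w.
  rewrite -(size_map f p) -last_map; apply: dist_le_path.
  by rewrite path_map; apply: sub_path vp => a b ab; rewrite /= fadj.
have [m Hm] := sep n.
pose r := dist y u + n + m + 1.
have [x /colored_disk_equivP[F [F' Fch]]] :
    exists x, colored_disk_equiv psi theta x y r.
  by apply: lim; rewrite /r addn1.
have Fch' := chart_sym Fch; have [Fx FD F'D Flab] := Fch; have [F'y _ _ F'lab] := Fch'.
have yfu : dist y (f u) <= dist y u + n by exact: dist_triangle.
have [xa Fa] := F'D u (ltac:(rewrite /r; lia)).
have [xb Fb] := F'D (f u) (ltac:(rewrite /r; lia)).
have [a aE] : exists a, a = F' u by exists (F' u).
have [b bE] : exists b, b = F' (f u) by exists (F' (f u)).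
rewrite -aE -bE in xa Fa xb Fb.
have ab : a != b by apply: contra_neq fu_neq => ab; rewrite -Fb -ab Fa.
have dab : dist a b <= n.
  by rewrite aE bE; apply: (chart_dist connH Fch'); rewrite /r -/n; lia.
have xau : dist x a <= dist y u.
  by rewrite -{1}F'y aE; apply: (chart_dist connH Fch'); rewrite dist_refl /r; lia.
have [p [sp ap up nop]] := Hm a b ab dab.
have pm v : v \in a :: p -> dist a v <= m.
  by move=> /(dist_mem_path ap); rewrite sp.
have far v : dist a v <= m -> dist x v <= r.
  move=> av; have := dist_triangle connG a x v; rewrite /r; lia.
have ffar v : dist a v <= m -> dist y (f (F v)) <= r.
  move=> av; have := dist_triangle connH (f u) y (f (F v)).
  have : dist (f u) (f (F v)) <= dist a v.
    rewrite (leq_trans (fdist _ _)) // -{1}Fa (chart_dist connG Fch) // /r; lia.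
  rewrite /r; lia.
pose h v := F' (f (F v)).
have hK v : dist a v <= m -> F' (f' (F (h v))) = v.
  move=> av; rewrite /h; have [_ ->] := F'D _ (ffar v av).
  by rewrite fK; case: (FD v (far v av)).
apply: (nop (map h p)).
  have -> : b = h a by rewrite /h Fa bE.
  rewrite -map_cons map_inj_in_uniq // => v w /pm av /pm aw hvw.
  by rewrite -(hK v av) hvw hK.
have -> : b = h a by rewrite /h Fa bE.
apply/esym/pairmap_map_in => v w /pm av /pm aw.
by rewrite /h F'lab ?ffar // flab Flab ?far.
Qed.

End LimitAperiodic.

(** * Compactness and minimal colorings *)

Section Compactness.
Local Open Scope classical_set_scope.
Variables (G : graph) (n : nat) (T : Type) (F : set_system T).
Variable psi : T -> coloring G 'I_n.
Hypothesis FF : ProperFilter F.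

Lemma filter_forall_seq (I : eqType) (U : set_system T) (s : seq I) (P : I -> set T) :
  Filter U -> (forall i, i \in s -> U (P i)) ->
  U [set t | forall i, i \in s -> P i t].
Proof.
move=> FU; elim: s => [|a s IH] Ps; first by apply: filterS filterT => t _ i.
have Us : U [set t | forall i, i \in s -> P i t].
  by apply: IH => i si; apply: Ps; rewrite inE si orbT.
have Ua : U (P a) by apply: Ps; exact: mem_head.
apply: filterS (filterI Ua Us) => t [Pa Pt] i; rewrite inE => /orP[/eqP -> //|].
exact: Pt.
Qed.

(** Compactness of the space of colorings: an ultrafilter finer than F decides
    the color of every edge, since the colors are finitely many, and the resulting
    coloring agrees with some psi_t on any given finite set D, with t in any given
    member of F. *)
Lemma cluster_coloring : exists phi : coloring G 'I_n,
  forall (D : seq G) (A : set T), F A ->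
  exists2 t, A t & {in D &, forall u v, lab (psi t) u v = lab phi u v}.
Proof.
have [U [UU FU]] := ultraFilterLemma FF.
have UF : Filter U by typeclasses eauto.
have ex (u v : G) (uv : adj u v) : exists c, U [set t | psi t u v uv = c].
  apply: contrapT => noc.
  have : U [set t | forall c, c \in enum 'I_n -> psi t u v uv <> c].
    apply: filter_forall_seq => c _.
    have [Uc|//] := in_ultra_setVsetC [set t | psi t u v uv = c] UU.
    by case: noc; exists c.
  by move=> /filter_ex[t /(_ (psi t u v uv))]; rewrite mem_enum; apply.
pose phi u v (uv : adj u v) := sval (cid (ex u v uv)).
have phiP u v (uv : adj u v) : U [set t | psi t u v uv = phi u v uv].
  exact: svalP (cid (ex u v uv)).
have phi_sym (u v : G) (uv : adj u v) (vu : adj v u) : phi u v uv = phi v u vu.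
  have /filter_ex[t [/= <- <-]] := @filterI _ _ UF _ _ (phiP u v uv) (phiP v u vu).
  exact: color_sym.
exists (Coloring phi_sym) => D A /FU UA.
have UD : U [set t | forall uv, uv \in [seq (u, v) | u <- D, v <- D] ->
    lab (psi t) uv.1 uv.2 = lab (Coloring phi_sym) uv.1 uv.2].
  apply: filter_forall_seq => -[u v] _ /=.
  case: (boolP (adj u v)) => [uv|nuv].
    by apply: filterS (phiP u v uv) => t /= e; rewrite !(lab_adj _ uv) /= e.
  by apply: filterS filterT => t _; rewrite !lab_nadj.
have /filter_ex[t [At tD]] := @filterI _ _ UF _ _ UA UD.
exists t => // u v uD vD; apply: (tD (u, v)).
by apply/allpairsP; exists (u, v).
Qed.

End Compactness.

(** The finite patterns of phi are among those of psi. *)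
Definition occurs (G H : graph) (C : Type) (phi : coloring G C)
    (psi : coloring H C) : Prop :=
  forall x r, exists y F F', chart phi psi x y r F F'.

Lemma chart_id (G : graph) (C : Type) (psi : coloring G C) x r :
  chart psi psi x x r id id.
Proof. by split. Qed.

Lemma occurs_refl (G : graph) (C : Type) (psi : coloring G C) : occurs psi psi.
Proof. by move=> x r; exists x, id, id; exact: chart_id. Qed.

Lemma occurs_trans (G H K : graph) (C : Type) (phi : coloring G C)
    (psi : coloring H C) (chi : coloring K C) :
  occurs phi psi -> occurs psi chi -> occurs phi chi.
Proof.
move=> h1 h2 x r; have [y [F [F' Fch]]] := h1 x r.
have [z [F1 [F1' F1ch]]] := h2 y r.
by exists z, (F1 \o F), (F' \o F1'); apply: chart_trans Fch F1ch.
Qed.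

Lemma occurs_limit_aperiodic (G : graph) (C : Type) (phi psi : coloring G C) :
  occurs phi psi -> limit_aperiodic psi -> limit_aperiodic phi.
Proof.
move=> occ lap H theta y connH lfH lim; apply: (lap H theta y) => // r r0.
have [x /colored_disk_equivP[F [F' Fch]]] := lim r r0.
have [x' [F1 [F1' /chart_sym F1ch]]] := occ x r.
exists x'; apply/colored_disk_equivP.
by exists (F \o F1'), (F1 \o F'); apply: chart_trans F1ch Fch.
Qed.

Lemma eq_chart (G H : graph) (C : Type) (phi phi' : coloring G C)
    (psi : coloring H C) x y r F F' :
  (forall u v, dist x u <= r -> dist x v <= r -> lab phi u v = lab phi' u v) ->
  chart phi psi x y r F F' -> chart phi' psi x y r F F'.
Proof. by move=> e [Fx FD F'D Flab]; split=> // u v xu xv; rewrite Flab ?e. Qed.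

Section MinimalColoring.
Local Open Scope classical_set_scope.
Variables (G : graph) (n : nat).
Hypothesis connG : graph_connected G.
Hypothesis lfG : locally_finite G.

(** Zorn's lemma for the order [occurs]. A cluster point of a chain is a lower
    bound: each of its patterns is a pattern of members of the chain that are
    arbitrarily far down, hence of all members. *)
Lemma minimal_coloring (psi : coloring G 'I_n) :
  exists2 phi : coloring G 'I_n, occurs phi psi &
    forall phi' : coloring G 'I_n, occurs phi' phi -> occurs phi phi'.
Proof.
pose T := {phi : coloring G 'I_n | occurs phi psi}.
pose R : rel T := fun s t => `[< occurs (sval t) (sval s) >].
pose t0 : T := exist (fun phi => occurs phi psi) psi (occurs_refl psi).
have [|||[phi phiP] max] := @ZL_preorder T t0 R.
- by move=> t; apply/asboolP/occurs_refl.
- by move=> r s t /asboolP rs /asboolP st; apply/asboolP/(occurs_trans st rs).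
- move=> A Atot; have [[s0 As0]|A0] := pselect (A !=set0); last first.
    by exists t0 => s As; case: A0; exists s.
  pose B s := [set t | A t /\ R s t].
  have FF : ProperFilter (filter_from A B).
    apply: filter_from_proper.
      apply: filter_from_filter; first by exists s0.
      have trans r s t : R r s -> R s t -> R r t.
        by move=> /asboolP rs /asboolP st; apply/asboolP/(occurs_trans st rs).
      move=> s t As At; have [st|ts] := Atot s t As At.
        by exists t => // w [Aw tw]; split; split => //; exact: trans st tw.
      by exists s => // w [Aw tw]; split; split => //; exact: trans ts tw.
    by move=> s As; exists s; split => //; apply/asboolP/occurs_refl.
  have [phi phiP] := cluster_coloring (fun t : T => sval t) FF.
  have occ s : A s -> occurs phi (sval s).
    move=> As x r.
    have [t [At /asboolP st] agree] := phiP (ball r x) (B s)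
      (ltac:(by exists s)).
    have [y [F [F' Fch]]] := st x r; exists y, F, F'.
    apply: eq_chart Fch => u v xu xv.
    by apply: agree; apply: mem_ball.
  have occ_psi : occurs phi psi by exact: occurs_trans (occ _ As0) (svalP s0).
  exists (exist (fun phi => occurs phi psi) phi occ_psi) => s As.
  exact/asboolP/occ.
exists phi => // phi' occ.
have occ' := occurs_trans occ phiP.
by have /asboolP := max (exist (fun phi => occurs phi psi) phi' occ')
  (ltac:(exact/asboolP)).
Qed.

(** With one color only, charts are isomorphisms of uncolored disks. *)
Definition uncolored : coloring G unit :=
  @Coloring G unit (fun _ _ _ => tt) (fun _ _ _ _ => erefl).

Lemma disk_equiv_chart x y r : disk_equiv x y r ->
  exists F F', chart uncolored uncolored x y r F F'.
Proof. by move=> [f [fiso fc]]; apply/colored_disk_equivP; exists f. Qed.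

(** The map F preserves adjacency only on a disk; elsewhere the color is
    arbitrary, and c itself serves as a default. *)
Definition pull_color (c : coloring G 'I_n) (F : G -> G) u v (uv : adj u v) : 'I_n :=
  if pselect (adj (F u) (F v)) is left h then c _ _ h else c _ _ uv.

Lemma pull_color_sym c F u v (uv : adj u v) (vu : adj v u) :
  pull_color c F uv = pull_color c F vu.
Proof.
rewrite /pull_color; case: pselect => [a|a]; case: pselect => [b|b].
- exact: color_sym.
- by case: b; rewrite adj_sym.
- by case: a; rewrite adj_sym.
- exact: color_sym.
Qed.

Definition pull c F : coloring G 'I_n := Coloring (@pull_color_sym c F).

Lemma lab_pull c F u v : adj (F u) (F v) = adj u v ->
  lab (pull c F) u v = lab c (F u) (F v).
Proof.
move=> e; case: (boolP (adj u v)) => [uv|nuv]; last by rewrite !lab_nadj ?e.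
have Fuv : adj (F u) (F v) by rewrite e.
rewrite (lab_adj _ uv) (lab_adj _ Fuv) /= /pull_color.
by case: pselect => // h; rewrite (bool_irrelevance h Fuv).
Qed.

Lemma chart_pull c x y r F F' : chart uncolored uncolored x y r F F' ->
  chart (pull c F) c x y r F F'.
Proof.
move=> [Fx FD F'D Flab]; split=> // u v xu xv; rewrite lab_pull //.
by rewrite -(isSome_lab uncolored) Flab ?isSome_lab.
Qed.

(** Suppose that the pattern P of c around p occurs with arbitrarily large gaps.
    The graph being repetitive, each gap contains a copy of a large disk around p.
    Pulling c back along these copies and passing to a cluster point gives a
    coloring phi whose patterns are patterns of c, but in which P does not occur,
    against minimality. *)
Lemma minimal_repetitive (c : coloring G 'I_n) : repetitive G ->
  (forall c' : coloring G 'I_n, occurs c' c -> occurs c c') ->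
  colored_repetitive c.
Proof.
move=> [p [rr [rr_gt0 rr_homo rr_unb dense]]] cmin.
exists p, rr; split=> // i0; apply: contrapT => ndense.
set S := [set x | _] in ndense.
(* A copy of the disk of radius m around p, far from all occurrences of P. *)
have sparse m : exists s F F', chart uncolored uncolored p s m F F' /\
    forall s', S s' -> m < dist s s'.
  have [i mi] := rr_unb m; have [ci ciP] := dense i.
  have [x xS] : exists x, forall s, S s -> ci + m < dist x s.
    apply: contrapT => nx; apply: ndense; exists (ci + m) => x.
    apply: contrapT => ns; apply: nx; exists x => s Ss.
    by rewrite ltnNge; apply/negP => le; apply: ns; exists s.
  have [s /disk_equiv_chart[F' [F /chart_sym Fch]] xs] := ciP x.
  exists s, F, F'; split.
    have [<- _ _ _] := Fch.
    by apply: (chart_sub connG connG Fch); rewrite dist_refl.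
  move=> s' /xS; have := dist_triangle connG s x s'; lia.
have {sparse} [s /choice[F]] := choice sparse.
move=> /choice[F' FP].
have [phi phiP] := cluster_coloring (fun m => pull c (F m)) eventually_filter.
have agree x r : exists2 m, dist p x + r <= m &
    forall u v, dist x u <= r -> dist x v <= r ->
      lab (pull c (F m)) u v = lab phi u v.
  have [|m /= km Hm] := phiP (ball r x) [set m | dist p x + r <= m].
    exact: nbhs_infty_ge.
  by exists m => // u v xu xv; apply: Hm; apply: mem_ball.
have charts x m r : dist p x + r <= m ->
    chart (pull c (F m)) c x (F m x) r (F m) (F' m).
  by have [/(chart_pull c) Fch _] := FP m; apply: (chart_sub connG connG Fch).
have occ : occurs phi c.
  move=> x r; have [m le lab_eq] := agree x r.
  exists (F m x), (F m), (F' m).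
  by apply: eq_chart (charts x m r le).
have [x' [F1 [F1' F1ch]]] := cmin phi occ p (rr i0).
have [m le lab_eq] := agree x' (rr i0).
have Sx : S (F m x').
  apply/colored_disk_equivP; exists (F1' \o F' m), (F m \o F1).
  by apply/chart_sym/(chart_trans F1ch (eq_chart lab_eq (charts x' m _ le))).
have [[Fp FD _ _] /(_ _ Sx)] := FP m.
(* The occurrence at x' lies within m of the center of the copy, in the gap. *)
have [] := FD x' (ltac:(lia)).
by rewrite leqNgt => /negP.
Qed.

End MinimalColoring.

(** * Greedy avoidance of coincidences along a rooted tree *)

Section Potential.
Variables (V : eqType) (o : V) (par : V -> V) (lev rank idx : V -> nat).
Variable q : nat.
Hypothesis lev_root : lev o = 0.
Hypothesis lev_par : forall c, c != o -> lev c = (lev (par c)).+1.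
Hypothesis rank_inj : injective rank.
Hypothesis rank_par : forall c, c != o -> rank (par c) < rank c.
Hypothesis q_gt0 : 0 < q.

Definition tree_child : rel V := fun u v => (v != o) && (par v == u).

(** Siblings have distinct labels for every choice of s, if idx numbers the
    children of a vertex by integers below q. *)
Definition label (s : V -> nat) (x : V) : nat := (idx x + s (par x)) %% q.

(** A coincidence to be excluded along a descending path: each edge of the path,
    represented by its lower end c, is paired with a target t, and the labels are
    not allowed to agree for all pairs. Events are attached to the vertex from
    which the path starts. *)
Definition event := seq (V * V).

(** When s is chosen in the order of rank, the label of every target is already
    known when the label of the corresponding edge is decided. *)
Definition predictable (e : event) : bool :=
  all (fun ct => rank (par ct.2) < rank (par ct.1)) e.

Variable E : V -> seq event.
Hypothesis E_predictable : forall v, all predictable (E v).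

Definition survives s c (e : event) : bool :=
  if e is (d, t) :: _ then (d == c) && (label s d == label s t) else false.

(** The events whose path runs through c and which have matched down to c,
    reduced to their remaining parts. Hence an event has been completed when the
    empty sequence becomes live. *)
Fixpoint live_at s n c : seq event :=
  if n is m.+1 then
    E c ++ [seq behead e | e <- live_at s m (par c) & survives s c e]
  else [::].

Definition live s c := live_at s (lev c) c.

Lemma live_root s : live s o = [::].
Proof. by rewrite /live lev_root. Qed.

Lemma liveE s c : c != o ->
  live s c = E c ++ [seq behead e | e <- live s (par c) & survives s c e].
Proof. by move=> co; rewrite /live lev_par. Qed.

Lemma lev_neq0 c n : lev c = n.+1 -> c != o.
Proof. by case: eqP => // ->; rewrite lev_root. Qed.

Lemma live_predictable s c : all predictable (live s c).
Proof.
rewrite /live; move: {1}(lev c) => n; elim: n c => //= n IH c.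
rewrite all_cat E_predictable all_map /=; apply/allP => e.
rewrite mem_filter => /andP[_ eL] /=.
by have /= := allP (IH (par c)) e eL; case: e {eL} => //= a e /andP[].
Qed.

Lemma eq_label s s' x : s (par x) = s' (par x) -> label s x = label s' x.
Proof. by rewrite /label => ->. Qed.

Lemma eq_live s s' c :
  (forall v, rank v < rank c -> s v = s' v) -> live s c = live s' c.
Proof.
move: {-1}(lev c) (erefl (lev c)) => n.
elim: n c => [|n IH] c lc ss'; first by rewrite /live lc.
have co := lev_neq0 lc.
have rp := rank_par co.
rewrite (liveE s co) (liveE s' co) (IH (par c)); first last.
- by move=> v vp; apply: ss'; apply: ltn_trans rp.
- by move: lc; rewrite lev_par // => -[].
congr (_ ++ [seq behead e | e <- _]); apply: eq_in_filter => e eL.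
have := allP (live_predictable s' (par c)) e eL.
case: e {eL} => //= -[d t] e /= /andP[rt _].
have [dc|//] := eqVneq d c; rewrite dc in rt *.
rewrite (@eq_label s s' c) ?(@eq_label s s' t) //; apply: ss' => //.
exact: ltn_trans rp.
Qed.

Lemma live_nil s v (e : event) :
  e \in live s v -> path tree_child v (unzip1 e) ->
  all (fun ct => label s ct.1 == label s ct.2) e ->
  [::] \in live s (last v (unzip1 e)).
Proof.
elim: e v => //= -[c t] e IH v ev /= /andP[/andP[co /eqP pc] pe] /andP[lct le].
apply: (IH c) => //; rewrite liveE // mem_cat; apply/orP; right.
apply/mapP; exists ((c, t) :: e) => //; rewrite mem_filter pc ev andbT.
by rewrite /= eqxx.
Qed.

Local Open Scope ring_scope.

Variables g eps : rat.
Hypothesis g_gt0 : 0 < g.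
Hypothesis eps_g : eps + (g * q%:R)^-1 < 1.
Hypothesis E_small : forall v, \sum_(e <- E v) g ^+ size e <= eps.

(** An event with k steps to go counts g ^ k, which approximates the chance that
    it will be completed; a completed event counts 1. *)
Definition potential s u : rat := \sum_(e <- live s u) g ^+ size e.

Definition advances s u (e : event) : bool :=
  if e is (d, t) :: _ then (par d == u) && (label s d == label s t) else false.

(** The part of the potential that survives the labeling of the children of u. *)
Definition passed s u : rat := \sum_(e <- live s u | advances s u e) g ^+ size e.

(** The events entering c are the new ones and those that pass from the parent;
    the latter have one step less to go, so their weight is multiplied by g^-1. *)
Lemma potential_child s c : c != o ->
  potential s c <= eps + g^-1 * passed s (par c).
Proof.
move=> co; rewrite /potential liveE // big_cat /=; apply: lerD; first exact: E_small.
rewrite big_map big_filter /passed mulr_sumr big_mkcond [leRHS]big_mkcond /=.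
apply: ler_sum => e _; case: e => [|[d t] e] /=; first by [].
have [dc|] := eqVneq d c; last first.
  by move=> _ /=; case: ifP => // _; rewrite mulr_ge0 ?exprn_ge0 ?invr_ge0 ?ltW.
rewrite dc eqxx /=; case: ifP => // _.
by rewrite exprS mulrA mulVf ?mul1r // gt_eqF.
Qed.

Definition upd (s : V -> nat) u a : V -> nat := fun v => if v == u then a else s v.

Lemma upd_ne s u a v : v != u -> upd s u a v = s v.
Proof. by rewrite /upd => /negbTE ->. Qed.

(** The targets of the events live at u have labels that do not depend on s(u),
    so each of these events is matched by at most one of the q values of s(u). The
    best value does at least as well as the average. *)
Lemma good_shift s u : exists a, q%:R * passed (upd s u a) u <= potential s u.
Proof.
have liveU a : live (upd s u a) u = live s u.
  apply: eq_live => v vu; rewrite upd_ne //.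
  by apply: contraTneq vu => ->; rewrite ltnn.
have le_sum : \sum_(a < q) passed (upd s u a) u <= potential s u.
  rewrite /passed; under eq_bigr => a _ do rewrite liveU big_mkcond.
  rewrite exchange_big /= /potential big_seq_cond [leRHS]big_seq_cond.
  apply: ler_sum => e /andP[eL _].
  have := allP (live_predictable s u) e eL.
  case: e {eL} => [|[d t] e] /=; first by rewrite big1 ?expr0 ?ler01.
  move=> /andP[rt _].
  rewrite -big_mkcond /= sumr_const -[leRHS]mulr1n; apply: ler_wpMn2l.
    by rewrite exprn_ge0 ?ltW.
  apply/card_le1P => a /andP[/eqP pd /eqP la] b; rewrite !inE.
  apply/idP/eqP => [/andP[_ /eqP lb]|->]; last by rewrite pd eqxx; apply/eqP.
  (* Changing s at u does not move the label of the target, as par t comes before u. *)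
  have tu : par t != u by apply: contraTneq rt => ->; rewrite pd ltnn.
  move: la lb; rewrite /label !(upd_ne _ _ tu) pd /upd eqxx => <- /eqP.
  by rewrite eqn_modDl !modn_small // => /eqP /val_inj.
case: (boolP [exists a : 'I_q, q%:R * passed (upd s u a) u <= potential s u]).
  by case/existsP => a; exists a.
rewrite negb_exists => /forallP noa.
have : \sum_(a < q) potential s u < \sum_(a < q) q%:R * passed (upd s u a) u.
  apply: ltr_sum => [|a _]; last by rewrite ltNge noa.
  by apply/hasP; exists (Ordinal q_gt0) => //; rewrite mem_index_enum.
rewrite -mulr_sumr sumr_const card_ord -[potential s u *+ q]mulr_natl.
by rewrite ltr_pM2l ?ltr0n // ltNge le_sum.
Qed.

Lemma eq_passed s s' u : (forall v, (rank v <= rank u)%N -> s v = s' v) ->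
  passed s u = passed s' u.
Proof.
move=> ss'; rewrite /passed (@eq_live s s'); last by move=> v /ltnW /ss'.
rewrite big_seq_cond [RHS]big_seq_cond; apply: eq_bigl => e.
case: (boolP (e \in _)) => //= eL.
have := allP (live_predictable s' u) e eL.
case: e {eL} => //= -[d t] e /= /andP[rt _].
have [du|//] := eqVneq (par d) u.
rewrite (@eq_label s s' d) ?(@eq_label s s' t) //; apply: ss'; first by rewrite -du ltnW.
by rewrite du.
Qed.

(** Choosing s(u) affects neither the potential at u nor anything at vertices of
    smaller rank, so the choices can be made one after the other. *)
Lemma good_shifts m : exists s, forall u, (rank u < m)%N ->
  q%:R * passed s u <= potential s u.
Proof.
elim: m => [|m [s Hs]]; first by exists (fun=> 0%N).
have [[u um]|nou] := pselect (exists u, rank u = m); last first.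
  exists s => u; rewrite ltnS leq_eqVlt => /orP[/eqP um|]; last exact: Hs.
  by case: nou; exists u.
have [a Ha] := good_shift s u; exists (upd s u a) => v.
rewrite ltnS leq_eqVlt => /orP[/eqP vm|vm].
  have -> : v = u by apply: rank_inj; rewrite vm.
  rewrite (le_trans Ha) // /potential (@eq_live (upd s u a) s) //.
  by move=> w wu; rewrite upd_ne //; apply: contraTneq wu => ->; rewrite ltnn.
have Hu w : (rank w <= rank v)%N -> upd s u a w = s w.
  move=> wv; rewrite upd_ne //; apply: contraTneq wv => ->.
  by rewrite -ltnNge um.
rewrite (eq_passed Hu) /potential (@eq_live _ s) ?Hs // => w /ltnW; exact: Hu.
Qed.

(** The recursion potential(c) <= eps + potential(par c) / (g q) keeps the
    potential below 1, starting from potential 0 at the root. A completed event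
    alone would contribute 1. *)
Lemma avoid_events m : exists s, forall v (e : event),
  v != o -> e \in E v -> path tree_child v (unzip1 e) ->
  (rank (last v (unzip1 e)) <= m)%N ->
  ~~ all (fun ct => label s ct.1 == label s ct.2) e.
Proof.
have [s Hs] := good_shifts m; exists s => v e vo eE pe rw; apply/negP => le.
set w := last v (unzip1 e) in rw.
have wo : w != o.
  move: pe; rewrite /w; clear -vo; case: (unzip1 e) => [|a p] //=.
  case/andP=> /andP[ao _]; elim: p a ao => //= b p IH a _ /andP[/andP[bo _]].
  exact: IH.
have small c : c != o -> (rank c <= m)%N -> potential s c < 1.
  move: {-1}(lev c) (erefl (lev c)) => n; elim: n c => [|n IH] c lc co cm.
    by move: lc; rewrite lev_par.
  have pm : (rank (par c) < m)%N by rewrite (leq_trans (rank_par co)).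
  have pp : potential s (par c) < 1.
    have [->|po] := eqVneq (par c) o; last first.
      by apply: IH => //; [move: lc; rewrite lev_par // => -[] | exact: ltnW].
    by rewrite /potential live_root big_nil ltr01.
  apply: le_lt_trans (potential_child _ co) _; apply: le_lt_trans eps_g.
  rewrite lerD2l invfM ler_pM2l ?invr_gt0 // -[leRHS]mulr1 ler_pdivlMl ?ltr0n //.
  by apply: le_trans (Hs _ pm) (ltW pp).
have : [::] \in live s w.
  by apply: live_nil => //; rewrite liveE // mem_cat eE.
move=> nilL; have := small w wo rw; rewrite ltNge => /negP; apply.
rewrite /potential (big_rem _ nilL) /= expr0 lerDl.
by apply: sumr_ge0 => f _; rewrite exprn_ge0 ?ltW.
Qed.

End Potential.

(** * Window lengths *)

(** Bernoulli's inequality for 1 + 1 / b, cleared of denominators. *)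
Lemma muln_exp_le b L : L * b ^ L <= b * b.+1 ^ L.
Proof.
elim: L => [|L IH]; first by rewrite mul0n.
rewrite mulSn !expnS mulnCA addnC.
have le : b ^ L <= b.+1 ^ L by case: L {IH} => // L; rewrite leq_exp2r.
have -> : b * (b.+1 * b.+1 ^ L) = b * (b * b.+1 ^ L) + b * b.+1 ^ L.
  by rewrite mulSn mulnDr addnC.
by rewrite leq_add // leq_mul2l ?IH ?le orbT.
Qed.

(** A length L for which ((D - 1) / (D - 1/2))^L beats the number of events of
    scale n, with room to sum over n; see [window_weight]. *)
Definition window D n := 32 * D ^ 2 * (2 * D.+1) ^ n.

Lemma window_gt0 D n : 0 < D -> 0 < window D n.
Proof. by move=> D0; rewrite /window !muln_gt0 !expn_gt0 D0. Qed.

Lemma window_entropy D n : 0 < D ->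
  2 * (D.-1 ^ window D n * D.+1 ^ n) * 2 ^ window D n * (8 * D * 2 ^ n)
  <= (2 * D.-1).+1 ^ window D n.
Proof.
move=> D0; set L := window D n.
have D2 : 0 < 2 * D by rewrite muln_gt0.
rewrite -(leq_pmul2l D2); apply: leq_trans (_ : L * (2 * D.-1) ^ L <= _).
  have LE : L = 2 * D * (16 * D * 2 ^ n * D.+1 ^ n).
    by rewrite /L /window -mulnn expnMn; lia.
  rewrite [X in _ <= X * _]LE expnMn; apply: eq_leq.
  move: (D.-1 ^ L) (2 ^ L) (2 ^ n) (D.+1 ^ n) => a b c d; lia.
apply: leq_trans (muln_exp_le _ _) _.
by rewrite leq_mul2r leq_mul2l leq_pred !orbT.
Qed.

Section Decay.
Local Open Scope ring_scope.

(** The inverse of D - 1/2. Any weight strictly between 1/D and 1/(D - 1) works: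
    the branching of descending paths must lose against the weight, and the weight
    against the number D of labels. *)
Definition decay D : rat := 2 / (2 * D.-1).+1%:R.

Lemma decay_gt0 D : 0 < decay D.
Proof. by rewrite divr_gt0 ?ltr0n. Qed.

(** The number of events of scale n attached to one vertex is at most the first
    factor; each has the length of the window. *)
Lemma window_weight D n : (0 < D)%N ->
  (2 * (D.-1 ^ window D n * D.+1 ^ n))%:R * decay D ^+ window D n
  <= (8 * D * 2 ^ n)%:R^-1.
Proof.
move=> D0; rewrite /decay expr_div_n mulrA.
rewrite ler_pdivrMr ?exprn_gt0 ?ltr0n // ler_pdivlMl; last first.
  by rewrite ltr0n !muln_gt0 D0 expn_gt0.
rewrite -!natrX -!natrM ler_nat mulnC; exact: window_entropy.
Qed.

Lemma sum_window_weight D N : (0 < D)%N ->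
  \sum_(n <- iota 0 N) (8 * D * 2 ^ n)%:R^-1 <= (4 * D)%:R^-1 :> rat.
Proof.
move=> D0; have D0' : D%:R != 0 :> rat by rewrite pnatr_eq0 -lt0n.
have -> : \sum_(n <- iota 0 N) (8 * D * 2 ^ n)%:R^-1 =
    (4 * D)%:R^-1 * (1 - (2 ^ N)%:R^-1) :> rat.
  elim: N => [|N IH]; first by rewrite big_nil expn0 invr1 subrr mulr0.
  rewrite -addn1 iotaD big_cat /= IH big_seq1 add0n addn1 expnS !natrM !natrX.
  by field; rewrite D0' /= expf_neq0.
by rewrite ler_piMr ?invr_ge0 ?ler0n // gerBl invr_ge0 ler0n.
Qed.

Lemma decay_gap D : (0 < D)%N -> (4 * D)%:R^-1 + (decay D * D%:R)^-1 < 1.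
Proof.
move=> D0; rewrite /decay.
have D0' : D%:R != 0 :> rat by rewrite pnatr_eq0 -lt0n.
have -> : (2 * D.-1).+1%:R = 2 * D%:R - 1 :> rat.
  by rewrite -[in RHS](prednK D0) -natr1 natrM -[_.+1%:R]natr1; ring.
have -> : (4 * D)%:R^-1 + (2 / (2 * D%:R - 1) * D%:R)^-1 = 1 - (4 * D)%:R^-1 :> rat.
  rewrite natrM; field; rewrite D0' /=.
  by rewrite subr_eq0 -natrM (eqr_nat _ _ 1); lia.
by rewrite gtrBl invr_gt0 ltr0n muln_gt0.
Qed.

End Decay.

(** * Coloring along a geodesic tree *)

Section Tree.
Variable X : graph.
Hypothesis conn : graph_connected X.
Variable o : X.

Local Notation lev := (dist o).

(** A neighbor that is one step closer to the root, and the root for itself. *)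
Definition par (x : X) : X :=
  if pselect (exists y, adj x y /\ lev x = (lev y).+1) is left h
  then sval (cid h) else o.

Lemma parP x : x != o -> adj x (par x) /\ lev x = (lev (par x)).+1.
Proof.
move=> xo; rewrite /par; case: pselect => [h|]; first exact: svalP (cid h).
by case; have [y] := dist_closer conn xo; exists y.
Qed.

Lemma lev_root : lev o = 0. Proof. exact: dist_refl. Qed.

Lemma par_root : par o = o.
Proof. by rewrite /par; case: pselect => // -[y []]; rewrite lev_root. Qed.

Lemma adj_par x : x != o -> adj x (par x). Proof. by case/parP. Qed.

Lemma lev_par x : x != o -> lev x = (lev (par x)).+1. Proof. by case/parP. Qed.

Lemma lev_gt0 x : (0 < lev x) = (x != o).
Proof.
have [->|xo] := eqVneq x o; first by rewrite lev_root.
by rewrite lev_par.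
Qed.

Local Notation child := (tree_child o par).

Lemma child_adj u v : child u v -> adj u v.
Proof. by case/andP => vo /eqP <-; rewrite adj_sym adj_par. Qed.

Lemma child_lev u v : child u v -> lev v = (lev u).+1.
Proof. by case/andP => vo /eqP <-; exact: lev_par. Qed.

Lemma lev_ind (P : X -> Prop) :
  P o -> (forall x, x != o -> P (par x) -> P x) -> forall x, P x.
Proof.
move=> Po IH x; move: {-1}(lev x) (erefl (lev x)) => n.
elim: n x => [|n IHn] x lx.
  by have [->//|xo] := eqVneq x o; move: lx; rewrite lev_par.
have xo : x != o by rewrite -lev_gt0 lx.
by apply: IH => //; apply: IHn; move: lx; rewrite lev_par // => -[].
Qed.

Lemma lev_iter x i : i <= lev x -> lev (iter i par x) = lev x - i.
Proof.
elim: i => [|i IH] ix; first by rewrite subn0.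
have := IH (ltnW ix); rewrite iterS => e.
have : iter i par x != o by rewrite -lev_gt0 e subn_gt0.
by move/lev_par; rewrite e; lia.
Qed.

Lemma iter_neq_root x i : i < lev x -> iter i par x != o.
Proof. by move=> ix; rewrite -lev_gt0 lev_iter ?subn_gt0 // ltnW. Qed.

Lemma dist_iter_par x i : dist x (iter i par x) <= i.
Proof.
elim: i => [|i IH]; first by rewrite dist_refl.
rewrite /= (leq_trans (dist_triangle conn (iter i par x) _ _)) // -addn1 leq_add //.
have [->|h] := eqVneq (iter i par x) o; first by rewrite par_root dist_refl.
exact/dist_adj/adj_par.
Qed.

(** The vertices x, par x, ..., each standing for the edge to its parent; so the
    labels along this list are those of the ascending path of n edges from x. *)
Definition up (x : X) n : seq X := mkseq (fun i => iter i par x) n.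

Lemma size_up x n : size (up x n) = n. Proof. exact: size_mkseq. Qed.

Lemma path_up x n : n <= lev x -> path child (iter n par x) (rev (up x n)).
Proof.
elim: n => //= n IH nx; rewrite /up mkseqS rev_rcons /= IH ?(ltnW nx) // andbT.
by rewrite /tree_child iter_neq_root // eqxx.
Qed.

Lemma last_up v x n : 0 < n -> last v (rev (up x n)) = x.
Proof. by case: n => // n _; rewrite /up /mkseq /= rev_cons last_rcons. Qed.

Hypothesis lf : locally_finite X.

Definition children u : seq X := [seq v <- nbrs u | child u v].

Lemma mem_children u v : (v \in children u) = child u v.
Proof.
rewrite mem_filter mem_nbrs //; case: (boolP (child u v)) => // /andP[vo /eqP <-].
by rewrite adj_sym adj_par.
Qed.

Variable D : nat.
Hypothesis D_ge2 : 2 <= D.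
Hypothesis deg : forall u : X, degree u <= D.

Lemma size_children u : u != o -> size (children u) <= D.-1.
Proof.
move=> uo; rewrite -ltnS prednK; last exact: ltnW.
rewrite (leq_trans _ (deg u)) // -size_nbrs.
apply: (@uniq_leq_size _ (par u :: children u)) => [|v].
  rewrite /= filter_uniq ?uniq_nbrs // andbT mem_children /tree_child.
  apply/negP => /andP[puo /eqP pp].
  have := lev_par uo; have := lev_par puo; rewrite pp; lia.
rewrite inE mem_nbrs // => /orP[/eqP ->|]; first exact: adj_par.
by rewrite mem_filter mem_nbrs // => /andP[].
Qed.

Definition idx x := index x (children (par x)).

Lemma idx_lt x : x != o -> idx x < D.
Proof.
move=> xo; have xc : x \in children (par x) by rewrite mem_children /tree_child xo eqxx.
rewrite (leq_trans _ (deg (par x))) // /idx.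
rewrite (leq_trans (_ : _ < size (children (par x)))) ?index_mem //.
by rewrite -size_nbrs size_filter count_size.
Qed.

Lemma idx_inj x y : x != o -> y != o -> par x = par y -> idx x = idx y -> x = y.
Proof.
move=> xo yo pxy ixy.
have xc : x \in children (par x) by rewrite mem_children /tree_child xo eqxx.
have yc : y \in children (par x) by rewrite mem_children /tree_child yo pxy eqxx.
by rewrite -(nth_index o xc) -/(idx x) ixy /idx -pxy nth_index.
Qed.

(** The rank reads the path from the root in base D, with an initial digit 1. So
    it orders the vertices by level, then lexicographically. What matters is that
    the order of two vertices is inherited by their parents, see [rank_le_par]:
    along two ascending paths the comparison never changes sides, and one of them
    can always serve as the target of the other. *)
Fixpoint rank_at n x := if n is m.+1 then D * rank_at m (par x) + idx x else 1.
Definition rank x := rank_at (lev x) x.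

Lemma rank_root : rank o = 1. Proof. by rewrite /rank lev_root. Qed.
Lemma rankE x : x != o -> rank x = D * rank (par x) + idx x.
Proof. by move=> xo; rewrite /rank lev_par. Qed.

Lemma rank_gt0 x : 0 < rank x.
Proof.
elim/lev_ind: x => [|x xo IH]; first by rewrite rank_root.
by rewrite rankE // addn_gt0 muln_gt0 IH andbT (ltnW D_ge2).
Qed.

Lemma rank_par x : x != o -> rank (par x) < rank x.
Proof.
move=> xo; rewrite (rankE xo) ltn_addr // -[X in X < _]mul1n.
by rewrite ltn_mul2r rank_gt0.
Qed.

Lemma rank_par_div x : x != o -> rank (par x) = rank x %/ D.
Proof.
move=> xo; have D0 : 0 < D by exact: ltnW.
by rewrite (rankE xo) mulnC divnMDl // divn_small ?idx_lt ?addn0.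
Qed.

Lemma rank_root_lt x : x != o -> 1 < rank x.
Proof. by move=> xo; apply: leq_ltn_trans (rank_par xo); exact: rank_gt0. Qed.

Lemma rank_inj : injective rank.
Proof.
move=> x; elim/lev_ind: x => [|x xo IH] y rxy.
  have [//|yo] := eqVneq y o.
  by have := rank_root_lt yo; rewrite -rxy rank_root.
have yo : y != o.
  by apply: contra_eq_neq rxy => ->; rewrite rank_root gtn_eqF ?rank_root_lt.
have pxy : par x = par y by apply: IH; rewrite !rank_par_div // rxy.
apply: idx_inj => //; move: rxy; rewrite (rankE xo) (rankE yo) pxy.
exact: addnI.
Qed.

Lemma rank_le_par x y : rank x <= rank y -> rank (par x) <= rank (par y).
Proof.
have [->|xo] := eqVneq x o; first by move=> _; rewrite par_root rank_root rank_gt0.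
have [->|yo] := eqVneq y o.
  by rewrite rank_root leqNgt rank_root_lt.
by move=> le; rewrite !rank_par_div // leq_div2r.
Qed.

Lemma rank_lev x y : lev x < lev y -> rank x < rank y.
Proof.
elim/lev_ind: x y => [|x xo IH] y lxy.
  have yo : y != o by rewrite -lev_gt0 (leq_ltn_trans _ lxy).
  by rewrite rank_root rank_root_lt.
have yo : y != o by rewrite -lev_gt0 (leq_ltn_trans _ lxy).
rewrite ltnNge; apply/negP => /rank_le_par; apply/negP; rewrite -ltnNge.
by apply: IH; move: lxy; rewrite (lev_par xo) (lev_par yo).
Qed.

Lemma rank_lt_exp x : rank x < D ^ (lev x).+1.
Proof.
elim/lev_ind: x => [|x xo IH]; first by rewrite rank_root lev_root expn1.
rewrite (rankE xo) (lev_par xo) expnS.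
apply: leq_trans (_ : D * (rank (par x)).+1 <= _).
  by rewrite mulnS addnC ltn_add2r idx_lt.
by rewrite leq_mul2l IH orbT.
Qed.

Fixpoint descents n v : seq (seq X) :=
  if n is m.+1 then [seq c :: p | c <- children v, p <- descents m c] else [:: [::]].

Lemma mem_descents v p : path child v p -> p \in descents (size p) v.
Proof.
elim: p v => //= c p IH v /andP[vc cp].
by apply/allpairsPdep; exists c, p; rewrite mem_children vc IH.
Qed.

Lemma size_in_descents n v p : p \in descents n v -> size p = n.
Proof.
elim: n v p => [|n IH] v p; first by rewrite inE => /eqP ->.
by move=> /allpairsPdep[c [p' [_ /IH <- ->]]].
Qed.

(** A vertex other than the root has at most D - 1 children, one of its neighbors
    being its parent. For this reason no events start at the root. *)
Lemma size_descents n v : v != o -> size (descents n v) <= D.-1 ^ n.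
Proof.
elim: n v => [|n IH] v vo //; rewrite [descents _ _]/= size_allpairs_dep.
have sz := size_children vo.
have : all (fun c => c != o) (children v).
  by apply/allP => c; rewrite mem_children => /andP[].
move=> so; rewrite expnS.
apply: leq_trans (_ : size (children v) * D.-1 ^ n <= _); last first.
  by rewrite leq_mul2r sz orbT.
elim: (children v) so {sz} => //= c s IHs /andP[co /IHs le].
by rewrite mulSn leq_add ?IH.
Qed.

(** The events of scale n that start at v. In the first list the path descends to
    the end point w of p and the targets are the edges of the ascending path of a
    vertex y near w, in the order from top to bottom. In the second list the
    targets are the edges of the ascending path of a vertex y near v, in the order
    in which it is traversed. *)
Definition events_at n v : seq (event X) :=
  [seq zip p (rev (up y (window D n))) |
     p <- descents (window D n) v, y <- ball n (last v p)] ++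
  [seq zip p (up y (window D n)) | p <- descents (window D n) v, y <- ball n v].

Definition events N v : seq (event X) :=
  if v == o then [::] else
  [seq e <- flatten [seq events_at n v | n <- iota 0 N] | predictable par rank e].

Lemma size_in_events n v e : e \in events_at n v -> size e = window D n.
Proof.
rewrite mem_cat => /orP[] /allpairsPdep[p [y [/size_in_descents sp _ ->]]].
  by rewrite size_zip size_rev size_up sp minnn.
by rewrite size_zip size_up sp minnn.
Qed.

Lemma size_events_at n v : v != o ->
  size (events_at n v) <= 2 * (D.-1 ^ window D n * D.+1 ^ n).
Proof.
move=> vo; rewrite size_cat !size_allpairs_dep mul2n -addnn.
have le (f : seq X -> X) :
    sumn [seq size (ball n (f p)) | p <- descents (window D n) v] <=
    D.-1 ^ window D n * D.+1 ^ n.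
  apply: leq_trans (_ : size (descents (window D n) v) * D.+1 ^ n <= _); last first.
    by rewrite leq_mul2r size_descents ?orbT.
  elim: (descents _ _) => //= p s IH; rewrite mulSn leq_add //.
  exact: size_ball.
by rewrite leq_add ?(le (last v)) ?(le (fun=> v)).
Qed.

Lemma events_small N v :
  (\sum_(e <- events N v) decay D ^+ size e <= (4 * D)%:R^-1)%R.
Proof.
have D0 : 0 < D by exact: ltnW.
rewrite /events; case: eqVneq => [_|vo]; first by rewrite big_nil invr_ge0 ler0n.
rewrite big_filter (le_trans _ (sum_window_weight N D0)) //.
apply: (@le_trans _ _ (\sum_(e <- flatten [seq events_at n v | n <- iota 0 N])
  decay D ^+ size e)%R).
  rewrite big_mkcond; apply: ler_sum => e _; case: ifP => // _.
  by rewrite exprn_ge0 ?ltW ?decay_gt0.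
rewrite big_flatten big_map; apply: ler_sum => n _.
apply: le_trans (window_weight n D0).
rewrite (eq_big_seq (fun=> decay D ^+ window D n)%R) => [|e /size_in_events -> //].
rewrite big_const_seq count_predT iter_addr_0 -[(_ *+ size _)%R]mulr_natl.
by rewrite ler_pM2r ?exprn_gt0 ?decay_gt0 // ler_nat size_events_at.
Qed.

Lemma events_predictable N v : all (predictable par rank) (events N v).
Proof. by rewrite /events; case: ifP => // _; exact: filter_all. Qed.

Definition tree_label (s : X -> nat) x := label par idx D s x.

Definition avoiding N m s := forall v e, v != o -> e \in events N v ->
  path child v (unzip1 e) -> rank (last v (unzip1 e)) <= m ->
  ~~ all (fun ct => tree_label s ct.1 == tree_label s ct.2) e.

Lemma exists_avoiding N m : exists s, avoiding N m s.
Proof.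
have D0 : 0 < D by exact: ltnW.
exact: (avoid_events idx lev_root lev_par rank_inj rank_par D0
  (events_predictable N) (decay_gt0 D) (decay_gap D0) (events_small N) m).
Qed.

Lemma rank_iter x i : rank (iter i par x) <= rank x.
Proof.
elim: i => //= i IH; apply: leq_trans IH.
have [->|h] := eqVneq (iter i par x) o; first by rewrite par_root.
exact/ltnW/rank_par.
Qed.

Lemma rank_iter_mono x y i : rank y <= rank x ->
  rank (iter i par y) <= rank (iter i par x).
Proof. by move=> yx; elim: i => //= i; exact: rank_le_par. Qed.

Lemma all_label_eq s (p t : seq X) :
  [seq tree_label s c | c <- p] = [seq tree_label s c | c <- t] ->
  all (fun ct => tree_label s ct.1 == tree_label s ct.2) (zip p t).
Proof. by elim: p t => [|a p IH] [|b t] //= [-> /IH ->]; rewrite eqxx. Qed.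

Section Avoiding.
Variables (N m : nat) (s : X -> nat).
Hypothesis sP : avoiding N m s.

(** Siblings have distinct labels. *)
Lemma tree_label_inj x y : x != o -> y != o -> par x = par y ->
  tree_label s x = tree_label s y -> x = y.
Proof.
move=> xo yo pxy; rewrite /tree_label /label pxy => /eqP.
by rewrite eqn_modDr !modn_small ?idx_lt // => /eqP; exact: idx_inj.
Qed.

Lemma up_labels_merge x y n : n <= lev x -> n <= lev y ->
  iter n par x = iter n par y ->
  [seq tree_label s t | t <- up x n] = [seq tree_label s t | t <- up y n] -> x = y.
Proof.
elim: n => // n IH nx ny; rewrite !iterS => pxy; rewrite /up !mkseqS !map_rcons.
move=> /rcons_inj[e1 e2]; apply: IH => //; try exact: ltnW.
by apply: tree_label_inj => //; exact: iter_neq_root.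
Qed.

(** Type (I). If the two ascending paths meet within the window, the labels below
    the meeting point differ because siblings have distinct labels. Otherwise the
    path of smaller rank is a predictable target for the other one. *)
Lemma up_labels_inj x y n : n < N -> dist x y <= n ->
  window D n < lev x -> window D n < lev y -> rank x <= m -> rank y <= m ->
  [seq tree_label s t | t <- up x (window D n)] =
  [seq tree_label s t | t <- up y (window D n)] -> x = y.
Proof.
wlog yx : x y / rank y <= rank x.
  move=> H; have [yx|/ltnW yx] := leqP (rank y) (rank x); first exact: H.
  by move=> nN xy *; apply/esym/H => //; rewrite dist_sym.
set L := window D n => nN xy Lx Ly xm ym e.
have L0 : 0 < L by apply: window_gt0; exact: ltnW.
have [pxy|pxy] := eqVneq (iter L par x) (iter L par y).
  by apply: up_labels_merge pxy e; exact: ltnW.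
set v := iter L par x.
have vo : v != o by exact: iter_neq_root.
have szE : size (rev (up x L)) = size (rev (up y L)) by rewrite !size_rev !size_up.
have E1 : unzip1 (zip (rev (up x L)) (rev (up y L))) = rev (up x L).
  by rewrite unzip1_zip // szE.
have := sP (e := zip (rev (up x L)) (rev (up y L))) vo.
rewrite E1 (path_up (ltnW Lx)) last_up // xm all_label_eq ?map_rev ?e //=.
suff -> : zip (rev (up x L)) (rev (up y L)) \in events N v.
  by move=> /(_ erefl erefl erefl).
rewrite /events (negbTE vo) mem_filter; apply/andP; split; last first.
  apply/flatten_mapP; exists n; first by rewrite mem_iota.
  rewrite mem_cat; apply/orP; left; apply/allpairsPdep.
  exists (rev (up x L)), y; split=> //; last by rewrite last_up // mem_ball.
  by have := mem_descents (path_up (ltnW Lx)); rewrite size_rev size_up.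
rewrite /predictable -rev_zip ?size_up // all_rev /up /mkseq.
rewrite zip_map all_map; apply/allP => i; rewrite mem_iota add0n /= => iL.
rewrite ltn_neqAle (rank_iter_mono i.+1 yx) andbT.
apply: contra_neq pxy => /rank_inj pi.
by rewrite -(subnK iL) !iterD [iter i.+1 par x]/= -pi.
Qed.

(** Type (II). The ascending path leaves x towards smaller ranks and the
    descending path leaves v towards larger ones, so the targets are predictable. *)
Lemma down_labels_neq v x p n : n < N -> v != o -> dist v x <= n ->
  rank x <= rank v -> path child v p -> size p = window D n ->
  rank (last v p) <= m ->
  [seq tree_label s t | t <- p] <> [seq tree_label s t | t <- up x (window D n)].
Proof.
set L := window D n => nN vo vx xv pp sp lm e.
have E1 : unzip1 (zip p (up x L)) = p by rewrite unzip1_zip // size_up sp.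
have := sP (e := zip p (up x L)) vo; rewrite E1 pp lm all_label_eq //=.
suff -> : zip p (up x L) \in events N v by move=> /(_ erefl erefl erefl).
rewrite /events (negbTE vo) mem_filter; apply/andP; split; last first.
  apply/flatten_mapP; exists n; first by rewrite mem_iota.
  rewrite mem_cat; apply/orP; right; apply/allpairsPdep.
  exists p, x; split=> //; last by rewrite mem_ball.
  by rewrite -/L -sp mem_descents.
have low : all (fun t => rank (par t) < rank v) (up x L).
  apply/allP => t /mapP[i _ ->].
  have [->|h] := eqVneq (iter i par x) o.
    by rewrite par_root rank_root rank_root_lt.
  by apply: leq_trans (rank_par h) (leq_trans (rank_iter x i) xv).
have high : all (fun c => rank v <= rank (par c)) p.
  suff gen w q : path child w q -> rank v <= rank w ->
      all (fun c => rank v <= rank (par c)) q by exact: (gen v p).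
  elim: q w => //= c q IH w /andP[/andP[co /eqP pc] cq] vw.
  by rewrite pc vw (IH c) // (leq_trans vw) // -pc ltnW ?rank_par.
move: (up x L) low high; clear; elim: p => [|c p IH] [|t u] //=.
move=> /andP[tv uv] /andP[vc pv]; rewrite (leq_trans tv vc) /=; exact: IH.
Qed.

End Avoiding.

Section PathGraph.
Hypothesis X_infinite : infinite_set [set: X]%classic.
Hypothesis D_eq2 : D = 2.

Lemma children_uniq u a b : u != o -> child u a -> child u b -> a = b.
Proof.
move=> /size_children; rewrite -!mem_children D_eq2.
by case: (children u) => [|c [|]] //= _; rewrite !inE => /eqP -> /eqP.
Qed.

(** Away from the root each vertex has at most one child, so vertices of the same
    level with a common ancestor other than the root coincide. *)
Lemma iter_par_inj i a b : lev a = lev b -> i < lev a ->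
  iter i par a = iter i par b -> a = b.
Proof.
move=> ab; elim: i => //= i IH ia pab; apply: IH; first exact: ltnW.
have ib : i.+1 < lev b by rewrite -ab.
apply: (@children_uniq (iter i.+1 par a)); first exact: iter_neq_root.
  by rewrite /tree_child eqxx iter_neq_root // ltnW.
by rewrite /tree_child /= pab eqxx iter_neq_root // ltnW.
Qed.

Lemma deg2_leaf x y : adj x y -> ~~ child x y -> ~~ child y x -> x != o ->
  forall c, ~~ child x c.
Proof.
move=> xy nxy nyx xo c; apply/negP => xc.
have : uniq [:: par x; y; c].
  rewrite /= !inE andbT negb_or -andbA; apply/and3P; split.
  - by apply: contraNneq nyx => <-; rewrite /tree_child xo eqxx.
  - by apply/eqP => pc; have := child_lev xc; rewrite -pc (lev_par xo); lia.
  - by apply: contraNneq nxy => ->.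
have sub : {subset [:: par x; y; c] <= nbrs x}.
  move=> w; rewrite !inE mem_nbrs // => /or3P[] /eqP -> //; first exact: adj_par.
  exact: child_adj.
move=> u3; have := leq_trans (uniq_leq_size u3 sub) (deg x).
by rewrite D_eq2.
Qed.

Lemma leaf_top_neq a b : (forall c, ~~ child a c) -> a != b -> 0 < lev a ->
  lev a <= lev b -> iter (lev a).-1 par a != iter (lev b).-1 par b.
Proof.
move=> leaf ab a0 le; apply/eqP.
have -> : (lev b).-1 = (lev a).-1 + (lev b - lev a) by lia.
rewrite iterD => /iter_par_inj.
rewrite lev_iter ?leq_subr // subKn // => /(_ erefl).
rewrite prednK // => /(_ (leqnn _)) ba.
case E : (lev b - lev a) ba => [|i] ba; first by rewrite ba eqxx in ab.
have := leaf (iter i par b).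
by rewrite /tree_child -iterS -ba eqxx andbT iter_neq_root //; lia.
Qed.

(** For D = 2 the graph is a line or a ray, and the tree contains all edges. An
    edge outside the tree would join two vertices x and y without children. For a
    vertex z further away than both, the ancestors of x, y and z at level 1 would
    be three distinct neighbors of the root. *)
Lemma path_graph_edge x y : adj x y -> child x y || child y x.
Proof.
wlog le : x y / lev x <= lev y.
  move=> H xy; case/orP: (leq_total (lev x) (lev y)) => le; first exact: H.
  by rewrite orbC H // adj_sym.
move=> xy; apply: contraT; rewrite negb_or => /andP[nxy nyx].
have yx : y != x by apply: contraTneq xy => ->; rewrite adj_irr.
have xo : x != o.
  apply: contraNneq nxy => xo; rewrite xo in xy yx *; rewrite /tree_child yx /=.
  apply/eqP/esym/(dist_eq0 conn); have := lev_par yx.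
  have := dist_adj xy; lia.
have lx0 : 0 < lev x by rewrite lev_gt0.
have yo : y != o by rewrite -lev_gt0 (leq_trans lx0).
have lfx := deg2_leaf xy nxy nyx xo.
have ayx : adj y x by rewrite adj_sym.
have lfy := deg2_leaf ayx nyx nxy yo.
have [z yz] := far_vertex conn lf o (lev y) X_infinite.
have neq a : lev a < lev z -> a != z by apply: contraTneq => ->; rewrite ltnn.
pose top a := iter (lev a).-1 par a.
have xz : lev x < lev z by exact: leq_ltn_trans le yz.
have u3 : uniq [:: top x; top y; top z].
  rewrite /= !inE andbT negb_or -andbA; apply/and3P; split; apply: leaf_top_neq;
    by rewrite ?lev_gt0 ?neq // 1?ltnW // eq_sym.
have top_adj a : a != o -> adj o (top a).
  move=> ao; rewrite /top; have la : 0 < lev a by rewrite lev_gt0.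
  have tl : lev (iter (lev a).-1 par a) = 1 by rewrite lev_iter ?leq_pred //; lia.
  have to : iter (lev a).-1 par a != o by rewrite -lev_gt0 tl.
  have := lev_par to; rewrite tl => -[] /esym /(dist_eq0 conn) pe.
  by rewrite [X in adj X _]pe adj_sym adj_par.
have /= := uniq_leq_size u3 (s2 := nbrs o).
have zo : z != o by rewrite -lev_gt0 (leq_trans _ yz).
have sub : {subset [:: top x; top y; top z] <= nbrs o}.
  by move=> w; rewrite !inE mem_nbrs // => /or3P[] /eqP ->; exact: top_adj.
by move=> /(_ sub); rewrite size_nbrs; have := deg o; rewrite D_eq2; lia.
Qed.

End PathGraph.

Section TreeColoring.
Hypothesis X_infinite : infinite_set [set: X]%classic.
Variable K : nat.
Hypothesis K_eq : K.+1 = 2 * D.-1.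
Variable s : X -> nat.

Definition edge_label x y :=
  if child x y then tree_label s y else if child y x then tree_label s x else D.

Lemma edge_label_sym x y : edge_label x y = edge_label y x.
Proof.
rewrite /edge_label; case: ifP => // /child_lev xy.
case: ifP => // /child_lev yx; move: xy.
by rewrite yx -addn2 -{1}[lev y]addn0 => /addnI.
Qed.

Definition tree_coloring : coloring X 'I_K.+1 :=
  @Coloring X 'I_K.+1 (fun x y _ => inord (edge_label x y))
    (fun x y _ _ => congr1 inord (edge_label_sym x y)).

Lemma tree_label_lt x : tree_label s x < D.
Proof. by rewrite ltn_mod ltnW. Qed.

Lemma lab_tree_up x : x != o ->
  lab tree_coloring x (par x) = Some (inord (tree_label s x)).
Proof.
move=> xo; rewrite (lab_adj _ (adj_par xo)) /= edge_label_sym /edge_label /tree_child.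
by rewrite xo eqxx.
Qed.

(** For D >= 3 the color D of the edges outside the tree is distinct from all
    labels. For D = 2 there are only two colors and D is not among them, but there
    are no edges outside the tree. *)
Lemma tree_coloring_inv x y l : l < D -> lab tree_coloring x y = Some (inord l) ->
  (child x y /\ tree_label s y = l) \/ (child y x /\ tree_label s x = l).
Proof.
move=> lD e; have xy : adj x y by rewrite -(isSome_lab tree_coloring) e.
have small a : a < D -> a < K.+1 by rewrite K_eq; lia.
move: e; rewrite (lab_adj _ xy) /= /edge_label => -[] /(congr1 val) /=.
case: ifP => [cxy|nxy].
  by rewrite !inordK ?small ?tree_label_lt //; left.
case: ifP => [cyx|nyx].
  by rewrite !inordK ?small ?tree_label_lt //; right.
have [D2|D2] := eqVneq D 2.
  by have := path_graph_edge X_infinite D2 xy; rewrite nxy nyx.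
have D3 : D < K.+1 by rewrite K_eq; lia.
by rewrite (inordK D3) (inordK (small _ lD)) => De; move: lD; rewrite De ltnn.
Qed.

End TreeColoring.

(** How far apart an ascending path from x and a walk from y can be after at most
    [window D n + n + 1] steps, if d(x, y) <= n. *)
Definition drift n := n + 2 * (window D n + n + 1).

(** Up to [window D n] steps for the ascent of the image path, n + 1 steps to
    descend below the level of the ascending path, and a window of type (II). *)
Definition sight n := window D n + n + 1 + window D (drift n).

(** A simple walk z in the tree never turns from descending to ascending, because
    it would return to the vertex that it came from. If z carries the labels of the
    ascending path from x and ascends during a whole window, this contradicts (I).
    If it turns at some time j before, then after n + 1 further steps it is at a
    higher level than the ascending path, and its descent contradicts (II). *)
Lemma walk_separated N m s n x y (z : nat -> X) : avoiding N m s ->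
  drift n < N -> x != y -> dist x y <= n -> sight n + n < lev x ->
  D ^ (lev x + n + sight n).+1 <= m -> z 0 = y ->
  (forall i, i < sight n ->
     (child (z i) (z i.+1) /\ tree_label s (z i.+1) = tree_label s (iter i par x)) \/
     (child (z i.+1) (z i) /\ tree_label s (z i) = tree_label s (iter i par x))) ->
  (forall i, i.+1 < sight n -> z i != z i.+2) -> False.
Proof.
move=> sP nN xy dxy far bound z0 step nonback.
set L := window D n; set M := sight n in far bound step nonback.
have ME : M = L + n + 1 + window D (drift n) by [].
have drE : drift n = n + 2 * (L + n + 1) by [].
have lxy : lev x <= lev y + n.
  by rewrite (leq_trans (dist_triangle conn y _ _)) // leq_add2l dist_sym.
have lyx : lev y <= lev x + n.
  by rewrite (leq_trans (dist_triangle conn x _ _)) // leq_add2l.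
(* Ranks up to m are controlled by s, and all vertices met below are in this range. *)
have low_rank v : lev v <= lev x + n + M -> rank v <= m.
  move=> lv; apply/ltnW/(leq_trans (rank_lt_exp v))/(leq_trans _ bound).
  by rewrite leq_exp2l.
(* The first descending step occurs within the window; otherwise (I) is violated. *)
have [j /andP[jL nup] jmin] : exists2 j, (j < L) && ~~ child (z j.+1) (z j) &
    forall i, i < j -> child (z i.+1) (z i).
  have [ex|nex] := pselect (exists j, (j < L) && ~~ child (z j.+1) (z j)).
    case: (ex_minnP ex) => j jP jmin; exists j => // i ij.
    have iL : i < L by case/andP: jP => jL _; exact: ltn_trans jL.
    by apply: contraT => ni; have := jmin i; rewrite iL ni leqNgt ij => /(_ erefl).
  have up i : i < L -> child (z i.+1) (z i).
    by move=> iL; apply: contraT => ni; case: nex; exists i; rewrite iL.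
  have zE i : i <= L -> z i = iter i par y.
    elim: i => // i IH iL; rewrite iterS -IH; last exact: ltnW.
    by case/andP: (up i iL) => _ /eqP.
  case/eqP: xy; apply: (up_labels_inj sP (n := n)) => //; rewrite ?low_rank -/L //.
  - by rewrite (leq_ltn_trans _ nN) // drE leq_addr.
  - by rewrite (leq_ltn_trans _ far) // ME -!addnA leq_addr.
  - by lia.
  - by lia.
  - by lia.
  rewrite /up /mkseq -!map_comp; apply/eq_in_map => i; rewrite mem_iota add0n => iL.
  rewrite /= -zE; last exact: ltnW.
  have iM : i < M by rewrite ME; move: iL; rewrite /=; lia.
  case: (step i iM) => [[/child_lev up1 _]|[_ ->] //].
  by have := child_lev (up i iL); rewrite up1; lia.
have zE i : i <= j -> z i = iter i par y.
  elim: i => // i IH ij; rewrite iterS -IH; last exact: ltnW.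
  by case/andP: (jmin i ij) => _ /eqP.
have down i : j <= i -> i < M -> child (z i) (z i.+1) /\
    tree_label s (z i.+1) = tree_label s (iter i par x).
  elim: i => [|i IH].
    rewrite leqn0 => /eqP j0 iM; case: (step 0 iM) => // -[up0 _].
    by rewrite j0 up0 in nup.
  rewrite leq_eqVlt => /orP[/eqP <- jM|ji iM].
    by case: (step j jM) => // -[upj _]; rewrite upj in nup.
  case: (step i.+1 iM) => // -[/andP[_ /eqP pz] _].
  have [/andP[_ /eqP pz'] _] := IH ji (ltnW iM).
  by have := nonback i iM; rewrite -pz' pz eqxx.
(* As lev x <= lev y + n, the walk is at a higher level than the ascending path at
   time i0. *)
pose i0 := j + n + 1.
have i0M : i0 + window D (drift n) <= M by rewrite ME /i0; lia.
have zlev i : j + i <= M -> lev (z (j + i)) = lev y - j + i.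
  elim: i => [|i IH] iM; first by rewrite !addn0 zE // lev_iter //; lia.
  rewrite !addnS in iM *; have [/child_lev -> _] := down (j + i) (leq_addr _ _) iM.
  by rewrite IH // ltnW.
have dz i : i <= M -> dist y (z i) <= i.
  elim: i => [|i IH] iM; first by rewrite z0 dist_refl.
  rewrite (leq_trans (dist_triangle conn (z i) _ _)) // -addn1 leq_add ?IH ?(ltnW iM) //.
  rewrite addn1; apply: dist_adj.
  by case: (step i iM) => -[/child_adj a _]; rewrite // adj_sym.
have zi0 : lev (z i0) = lev y - j + n + 1.
  have le : j + (n + 1) <= M by move: i0M; rewrite /i0; lia.
  by have := zlev _ le; rewrite !addnA.
have xi0 : lev (iter i0 par x) = lev x - i0 by rewrite lev_iter // /i0; lia.
set W := window D (drift n) in ME i0M *.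
apply: (down_labels_neq sP (v := z i0) (x := iter i0 par x)
  (p := mkseq (fun i => z (i0 + i.+1)) W) nN).
- by rewrite -lev_gt0 zi0; lia.
- have := dist_triangle conn y (z i0) (iter i0 par x).
  have := dist_triangle conn x y (iter i0 par x).
  have := dist_iter_par x i0; have := dz i0 (leq_trans (leq_addr _ _) i0M).
  rewrite (dist_sym conn (z i0) y) (dist_sym conn y x) drE /i0; lia.
- by apply/ltnW/rank_lev; rewrite xi0 zi0 /i0; lia.
- suff H w k : i0 + k + w <= M ->
      path child (z (i0 + k)) [seq z (i0 + i.+1) | i <- iota k w].
    by have := H W 0; rewrite !addn0; apply.
  elim: w k => //= w IH k kw; rewrite [_ + k.+1]addnS.
  have [-> _] := down (i0 + k) (ltac:(rewrite /i0; lia)) (ltac:(lia)).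
  by rewrite -addnS IH //; lia.
- exact: size_mkseq.
- have -> : last (z i0) (mkseq (fun i => z (i0 + i.+1)) W) = z (i0 + W).
    have : 0 < W by rewrite window_gt0 // ltnW.
    by case: W {ME i0M} => // w _; rewrite mkseqS last_rcons.
  apply: low_rank; have -> : i0 + W = j + (n + 1 + W) by rewrite /i0; lia.
  by rewrite zlev; move: i0M; rewrite /i0; lia.
- rewrite /up /mkseq -!map_comp; apply/eq_in_map => i; rewrite mem_iota add0n /= => iW.
  have [_] := down (i0 + i) (ltac:(rewrite /i0; lia)) (ltac:(lia)).
  by rewrite addnS => ->; rewrite addnC iterD.
Qed.

End Tree.

(** * Existence of separated colorings *)

Section Existence.
Variable X : graph.
Hypothesis conn : graph_connected X.
Hypothesis lf : locally_finite X.
Hypothesis X_infinite : infinite_set [set: X]%classic.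
Variable D : nat.
Hypothesis D_ge2 : 2 <= D.
Hypothesis deg : forall u : X, degree u <= D.
Variable K : nat.
Hypothesis K_eq : K.+1 = 2 * D.-1.

(** Coloring the tree rooted at o separates the vertices whose level is large,
    but bounded by h; the bounds on n and on the level keep the list of events and
    the range of ranks finite. *)
Lemma rooted_coloring (o : X) N h : exists psi : coloring X 'I_K.+1,
  forall n x y, drift D n < N -> x != y -> dist x y <= n ->
    sight D n + n < dist o x -> dist o x <= h ->
    exists p, [/\ size p = sight D n, path (@adj X) x p, uniq (x :: p) &
      forall p', uniq (y :: p') -> pairmap (lab psi) x p <> pairmap (lab psi) y p'].
Proof.
pose m := \max_(n < N) D ^ (h + n + sight D n).+1.
have [s sP] := exists_avoiding conn o lf D_ge2 deg N m.
pose psi := tree_coloring conn o D K s.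
exists psi => n x y nN xy dxy far xh.
set M := sight D n in far *.
have nroot i : i <= M -> iter i (par o) x != o.
  by move=> iM; apply: iter_neq_root => //; lia.
pose p := mkseq (fun i => iter i.+1 (par o) x) M.
have pE : x :: p = mkseq (fun i => iter i (par o) x) M.+1.
  by rewrite /p /mkseq /= -[1]addn0 iotaDl -map_comp.
exists p; split.
- exact: size_mkseq.
- suff H w k : k + w <= M ->
      path (@adj X) (iter k (par o) x) [seq iter i.+1 (par o) x | i <- iota k w].
    exact: (H M 0).
  elim: w k => //= w IH k kw; rewrite adj_par //=; last by apply: nroot; lia.
  by apply: (IH k.+1); lia.
- rewrite pE /mkseq map_inj_in_uniq ?iota_uniq // => i j.
  rewrite !mem_iota !add0n /= => iM jM /(congr1 (dist o)).
  by rewrite !lev_iter //; lia.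
move=> p' up' e.
have sp' : size p' = M by rewrite -(size_pairmap (lab psi) y) -e size_pairmap size_mkseq.
pose z i := nth y (y :: p') i.
apply: (walk_separated conn lf D_ge2 deg (n := n) (x := x) (y := y) (z := z) sP) => //.
- have nN' : n < N by rewrite (leq_ltn_trans _ nN) // leq_addr.
  apply: leq_trans (leq_bigmax (Ordinal nN')).
  by rewrite /= leq_exp2l // ltnS !leq_add2r.
- move=> i iM.
  have : nth None (pairmap (lab psi) x p) i = nth None (pairmap (lab psi) y p') i.
    by rewrite e.
  rewrite (nth_pairmap x) ?size_mkseq // (nth_pairmap y) ?sp' // pE.
  rewrite !nth_mkseq ?(leqW iM) //.
  rewrite [iter i.+1 _ _]/= lab_tree_up //; last by apply: nroot; exact: ltnW.
  move/esym/tree_coloring_inv; apply=> //.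
  exact: tree_label_lt.
- move=> i iM; rewrite /z nth_uniq //= ?sp' //; try lia.
Qed.

(** Take roots r_k at distance more than k from x0. Every vertex has large level
    for all but finitely many of these roots, so a cluster point of the rooted
    colorings is separated without exception. The path that separates x from y
    may depend on k, but its length does not, so that it lives on a finite set
    where the cluster point agrees with some rooted coloring. *)
Lemma exists_separated : exists psi : coloring X 'I_K.+1, separated psi.
Proof.
have [x0 _] := infinite_inhabited X_infinite.
have [r rP] := choice (fun k => far_vertex conn lf x0 k X_infinite).
have [psi psiP] := choice (fun k => rooted_coloring (r k) k (dist x0 (r k) + k)).
have [phi phiP] := cluster_coloring psi eventually_filter.
exists phi => n; exists (sight D n) => x y xy dxy.
pose B := drift D n + sight D n + n + dist x0 x.
have [|k /= kB agree] := phiP (ball (n + sight D n) x) [set k | B < k]%classic.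
  exact: nbhs_infty_gt.
have [|||p [sp xp up nop]] := psiP k n x y _ xy dxy.
- by move: kB; rewrite /B; lia.
- have := dist_triangle conn x x0 (r k); have := rP k.
  rewrite (dist_sym conn (r k)); move: kB; rewrite /B; lia.
- have := dist_triangle conn x0 x (r k).
  have := dist_triangle conn x0 (r k) x.
  rewrite (dist_sym conn (r k) x0); move: kB; rewrite /B; lia.
exists p; split=> // p' up' e; apply: (nop p' up').
have e1 : pairmap (lab (psi k)) x p = pairmap (lab phi) x p.
  have near w : w \in x :: p -> w \in ball (n + sight D n) x.
    by move=> /(dist_mem_path xp); rewrite sp => wM; apply: mem_ball => //; lia.
  by apply: eq_in_pairmap => u v /near ? /near; exact: agree.
(* Equal label sequences force p' to be a path of the same length, near x. *)
have yp' : path (@adj X) y p' by rewrite (path_pairmap phi) -e -path_pairmap.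
have sp' : size p' = sight D n.
  by rewrite -sp -(size_pairmap (lab phi) y) -e size_pairmap.
have near w : w \in y :: p' -> w \in ball (n + sight D n) x.
  move=> /(dist_mem_path yp'); rewrite sp' => wM; apply: mem_ball => //.
  by rewrite (leq_trans (dist_triangle conn y _ _)) // leq_add.
by rewrite e1 e; apply/esym/eq_in_pairmap => u v /near ? /near; exact: agree.
Qed.

End Existence.

(** Without a uniform bound, the supremum of the degrees is infinite. *)
Lemma graph_degree_cases (R : realType) (X : graph) :
  graph_degree R X = +oo%E \/ exists D, forall u : X, degree u <= D.
Proof.
have [bd|unbd] := pselect (exists D, forall u : X, degree u <= D); [by right|left].
apply/eqyP => A A0; have [u Au] : exists u : X, (A <= (degree u)%:R)%R.
  apply: contrapT => nu; apply: unbd; exists (Num.truncn A).+1 => u.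
  rewrite -(ler_nat R); apply: ltW; apply: lt_trans (truncnS_gt A).
  by rewrite ltNge; apply/negP => Au; apply: nu; exists u.
apply: (@le_trans _ _ ((degree u)%:R%:E)%E); first by rewrite lee_fin.
by apply: ereal_sup_ubound; exists u.
Qed.

Theorem corollary1p5 (R : realType) (X : graph)
    (X_infinite : infinite_set [set: X]%classic)
    (X_countable : countable [set: X]%classic)
    (X_connected : graph_connected X)
    (X_locally_finite : locally_finite X) :
  (DI_L R X <= 2%:E * (graph_degree R X - 1))%E /\
  (repetitive X -> (DI_RL R X <= 2%:E * (graph_degree R X - 1))%E).
Proof.
have [->|[B degB]] := graph_degree_cases R X.
  by rewrite addye // gt0_muley ?leey // lte_fin.
have [u u2] := degree_ge2 X_connected X_locally_finite X_infinite.
pose attained D := `[< exists v : X, degree v = D >].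
have exD : exists D, attained D.
  by exists (degree u); apply/asboolP; exists u.
have Dle D : attained D -> D <= B.
  by move=> /asboolP[v <-].
have [D] := @ex_maxnP attained B exD Dle => - /asboolP[v vD] Dmax.
have deg (w : X) : degree w <= D by apply: Dmax; apply/asboolP; exists w.
have D2 : 2 <= D by exact: leq_trans (deg u).
have KE : (2 * D.-1).-1.+1 = 2 * D.-1 by lia.
have bound : (((2 * D.-1).-1.+1)%:R%:E <= 2%:E * (graph_degree R X - 1) :> \bar R)%E.
  rewrite KE; have -> : ((2 * D.-1)%:R%:E = 2%:E * (D%:R%:E - 1) :> \bar R)%E.
    rewrite natrM -EFinB -EFinM; congr (_ * _)%:E%E.
    by rewrite -[in RHS](prednK (ltnW D2)) -natr1 addrK.
  apply: lee_wpmul2l; first by rewrite lee_fin.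
  by apply: leeB => //; apply: ereal_sup_ubound; exists v => //; rewrite vD.
have [psi sep] := exists_separated X_connected X_locally_finite X_infinite D2 deg KE.
have lap := separated_limit_aperiodic X_connected sep.
split=> [|rep]; apply: le_trans bound; apply: ereal_inf_lbound;
  exists (2 * D.-1).-1.+1 => //; split=> //.
  by exists psi.
have [phi occ min] := minimal_coloring X_connected X_locally_finite psi.
exists phi; split; last exact: occurs_limit_aperiodic occ lap.
exact: minimal_repetitive.
Qed.
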